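(* For complex parameters $a,b,c,e$ the following identity holds: $$ \begin{aligned} {}_{3}F_2\!\left(\begin{matrix}a,c,b\\ e,b+1\end{matrix}\right)={}&\frac{bc}{b-c}\left\{{}_{2}\hat{F}_1\!\left(\left.\begin{matrix}a-1,c\\ e\end{matrix}\right\vert b\right)+\frac{a+c-e}{e}\,{}_{2}\hat{F}_1\!\left(\left.\begin{matrix}a,c+1\\ e+1\end{matrix}\right\vert b+1\right)\right\}\\ &+\left(1+\frac{c^2}{(b-c)(e-a)}\right)\frac{\Gamma(e)\Gamma(e-a-c)}{\Gamma(e-a)\Gamma(e-c)}. \end{aligned} $$
   Context: Notation: $(x)_0=1$, $(x)_n=x(x+1)\cdots(x+n-1)$ is the rising factorial, $\psi=\Gamma'/\Gamma$ is the logarithmic derivative of the gamma function, and the hypergeometric function is evaluated at unit argument, which is omitted from the notation: $$ {}_3F_2\!\left(\begin{array}{c} a_1,a_2,a_3\\ b_1,b_2\end{array}\right)=\sum_{n=0}^\infty \frac{(a_1)_n(a_2)_n(a_3)_n}{(b_1)_n(b_2)_n\,n!} $$ (no lower parameter is a non-positive integer). The function ${}_2\hat F_1$ is defined by $$ {}_{2}\hat{F}_1\!\left(\left.\begin{matrix}a,c\\ e\end{matrix}\right\vert b\right):=\sum_{k=1}^{\infty}\frac{(a)_k(c)_{k}}{(e)_k\,k!}\big(\psi(b+k)-\psi(b)\big). $$ Standing convention: the parameters are assumed to be chosen so that all infinite series in the statement converge and the rational and gamma functions appearing in the formulas do not become infinite (all denominators are nonzero). *)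

(* Defs.v *)
From Stdlib Require Import Reals Factorial.
From Coquelicot Require Import Coquelicot.

Local Open Scope C_scope.

Definition nonpos_int (z : C) : Prop := exists n : nat, z = RtoC (- INR n).

Fixpoint poch (x : C) (n : nat) : C :=
  match n with
  | O => 1
  | S m => poch x m * (x + RtoC (INR m))
  end.

Definition Cexp (z : C) : C :=
  RtoC (exp (Re z)) * (cos (Im z), sin (Im z)).

(* Componentwise limit and sum: these are the limit and the sum in C for
   convergent sequences and series, and junk values otherwise. *)
Definition Clim_seq (u : nat -> C) : C :=
  (real (Lim_seq (fun n => Re (u n))), real (Lim_seq (fun n => Im (u n)))).

Definition Cseries (u : nat -> C) : C :=
  (Series (fun n => Re (u n)), Series (fun n => Im (u n))).

Definition ex_Cseries (u : nat -> C) : Prop :=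
  @ex_series C_AbsRing C_NormedModule u.

(* Gauss's limit  Gamma(z) = lim n! n^z / (z (z+1) ... (z+n)), with
   n^z = exp (z ln n); it converges to the meromorphic gamma function at every
   z which is not a non-positive integer.  The values at the poles are junk. *)
Definition CGamma (z : C) : C :=
  Clim_seq (fun n =>
    RtoC (INR (fact n)) * Cexp (z * RtoC (ln (INR n))) / poch z (S n)).

(* Gamma is holomorphic off its poles, so there C_derive is its complex
   derivative. *)
Definition digamma (z : C) : C := C_derive CGamma z / CGamma z.

Definition hyp3F2_term (a1 a2 a3 b1 b2 : C) (n : nat) : C :=
  poch a1 n * poch a2 n * poch a3 n
    / (poch b1 n * poch b2 n * RtoC (INR (fact n))).

Definition hyp3F2 (a1 a2 a3 b1 b2 : C) : C :=
  Cseries (hyp3F2_term a1 a2 a3 b1 b2).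

Definition hyp2F1hat_term (a c e b : C) (k : nat) : C :=
  poch a k * poch c k / (poch e k * RtoC (INR (fact k)))
    * (digamma (b + RtoC (INR k)) - digamma b).

(* The sum runs over k >= 1. *)
Definition hyp2F1hat (a c e b : C) : C :=
  Cseries (fun j => hyp2F1hat_term a c e b (S j)).

Definition ex_hyp3F2 (a1 a2 a3 b1 b2 : C) : Prop :=
  ex_Cseries (hyp3F2_term a1 a2 a3 b1 b2).

Definition ex_hyp2F1hat (a c e b : C) : Prop :=
  ex_Cseries (fun j => hyp2F1hat_term a c e b (S j)).

(* Main.v *)
Require Import Defs.
From Stdlib Require Import Reals.
From Coquelicot Require Import Coquelicot.
From Stdlib Require Import Factorial Lra Lia Psatz.
Local Open Scope C_scope.

(** Put [f_k = (a)_k (c)_k / ((e)_k k!)] and [h_k = psi (b+k) - psi b].  The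
    functional equation of the gamma function gives [h_k] as the sum of
    [1 / (b+j)] over [j < k], so that the identity becomes a summation by parts.
    In the combination in braces, the second series has the factor
    [psi (b+1+k) - psi (b+1) = h_(k+1) - 1/b]; after collecting the coefficients of
    [h_(k+1)], these turn out to be, up to the factor [1/c], the differences of
    [(c+k) f_k].  Summing by parts replaces [h] by its
    increments [1 / (b+k)], and [(c+k) / (b+k) = 1 + (c-b) / (b+k)] then splits the
    result into the series of [f_k] and the series of [f_k b / (b+k)], which is the
    3F2 of the left-hand side ([partial_sum_identity]).  What remains are two 2F1
    series at unit argument, with parameters [(a, c; e)] and [(a, c+1; e+1)]; both
    are summed by Gauss's theorem, and their contributions add up to the
    coefficient of the gamma quotient.

    Passing to the limit needs the boundary term [(c+N) f_N h_N] to vanish and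
    Gauss's theorem to be applicable, while only the convergence, possibly
    conditional, of the three series is known.  Everything is
    extracted from the convergence of the second series with digamma factors.  Its
    terms [x_k] vary slowly, [x_(k+1) - x_k = O(x_k / k)], and a convergent series
    of slowly varying terms has [k x_k -> 0] ([slow_variation_summable]).  As the
    digamma factor is bounded away from 0 for large [k], the hypergeometric terms
    are [o(1/k)] too ([hat_term_o_inv], [hyp2F1_term_o_inv]).  Terminating
    series are covered without a case distinction.

    Gauss's theorem is proved under this condition alone ([gauss_summation]).  The
    contiguous relation between [e] and [e+1] holds for partial sums up to a
    boundary term [N f_N]; iterating it moves the lower parameter to infinity,
    where the series tends to 1, and the Pochhammer quotients that accumulate tend
    to the gamma quotient by Gauss's limit formula.

    The analysis of the gamma function consists of the convergence of Gauss's limit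
    to a nonzero value and its differentiability along horizontal lines.  Both
    follow in the right half-plane from the logarithm of the approximants, whose
    increments are [O(1/n^2)] together with their derivatives
    ([log_Gamma_spec]), and propagate to all other points by the functional
    equation ([right_half_plane_ind]). *)

(** * Complex limits and partial sums *)

(** Componentwise, so that every limit rule below reduces to the real one, and so
    that it matches the componentwise [Clim_seq] and [Cseries]. *)
Definition is_Clim (u : nat -> C) (l : C) : Prop :=
  is_lim_seq (fun n => Re (u n)) (Re l) /\ is_lim_seq (fun n => Im (u n)) (Im l).

Fixpoint csum (u : nat -> C) (n : nat) : C :=
  match n with
  | O => 0
  | S m => csum u m + u m
  end.

Lemma C_eq (z w : C) : Re z = Re w -> Im z = Im w -> z = w.
Proof. destruct z, w; simpl; intros; subst; reflexivity. Qed.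

Lemma is_Clim_unique u l l' : is_Clim u l -> is_Clim u l' -> l = l'.
Proof.
  intros [H1 H2] [H3 H4]; apply C_eq.
  - apply is_lim_seq_unique in H1; apply is_lim_seq_unique in H3; congruence.
  - apply is_lim_seq_unique in H2; apply is_lim_seq_unique in H4; congruence.
Qed.

Lemma is_Clim_Clim_seq u l : is_Clim u l -> Clim_seq u = l.
Proof.
  intros [H1 H2]; unfold Clim_seq.
  rewrite (is_lim_seq_unique _ _ H1), (is_lim_seq_unique _ _ H2).
  now apply C_eq.
Qed.

Lemma is_Clim_ext_loc u v l :
  eventually (fun n => u n = v n) -> is_Clim u l -> is_Clim v l.
Proof.
  intros [N HN] [H1 H2]; split;
    [apply is_lim_seq_ext_loc with (2 := H1) | apply is_lim_seq_ext_loc with (2 := H2)];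
    exists N; intros n Hn; now rewrite HN.
Qed.

Lemma is_Clim_ext u v l : (forall n, u n = v n) -> is_Clim u l -> is_Clim v l.
Proof. intros H; apply is_Clim_ext_loc; now exists 0%nat. Qed.

Lemma is_Clim_const l : is_Clim (fun _ => l) l.
Proof. split; apply is_lim_seq_const. Qed.

Lemma is_Clim_plus u v l m :
  is_Clim u l -> is_Clim v m -> is_Clim (fun n => u n + v n) (l + m).
Proof. intros [H1 H2] [H3 H4]; split; simpl; now apply is_lim_seq_plus'. Qed.

Lemma is_Clim_mult u v l m :
  is_Clim u l -> is_Clim v m -> is_Clim (fun n => u n * v n) (l * m).
Proof.
  intros [H1 H2] [H3 H4]; split; simpl.
  - apply is_lim_seq_minus'; now apply is_lim_seq_mult'.
  - apply is_lim_seq_plus'; now apply is_lim_seq_mult'.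
Qed.

Lemma is_Clim_scal k u l : is_Clim u l -> is_Clim (fun n => k * u n) (k * l).
Proof. apply is_Clim_mult, is_Clim_const. Qed.

Lemma C_neq_0_norm2 (z : C) : z <> 0 -> (fst z ^ 2 + snd z ^ 2 <> 0)%R.
Proof.
  intros Hz H; apply Hz, C_eq; simpl; unfold Re, Im; simpl; nra.
Qed.

Lemma is_Clim_inv (u : nat -> C) (l : C) : l <> 0 -> is_Clim u l -> is_Clim (fun n => / u n) (/ l).
Proof.
  intros Hl [H1 H2]; pose proof (C_neq_0_norm2 l Hl) as Hl2.
  assert (Hn : is_lim_seq (fun n => (fst (u n) ^ 2 + snd (u n) ^ 2)%R)
                 (fst l ^ 2 + snd l ^ 2)%R).
  { simpl; apply is_lim_seq_plus';
      repeat apply is_lim_seq_mult'; try assumption; apply is_lim_seq_const. }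
  split; simpl; apply is_lim_seq_div'; try assumption.
  now apply (is_lim_seq_opp _ (Im l)).
Qed.

Lemma is_Clim_div (u v : nat -> C) (l m : C) :
  m <> 0 -> is_Clim u l -> is_Clim v m -> is_Clim (fun n => u n / v n) (l / m).
Proof. intros Hm Hu Hv; apply is_Clim_mult; [assumption | now apply is_Clim_inv]. Qed.

Lemma is_Clim_incr u l : is_Clim (fun n => u (S n)) l <-> is_Clim u l.
Proof.
  unfold is_Clim.
  rewrite <- (is_lim_seq_incr_1 (fun n => Re (u n))).
  rewrite <- (is_lim_seq_incr_1 (fun n => Im (u n))). reflexivity.
Qed.

Lemma is_Clim_0_Cmod u : is_Clim u 0 <-> is_lim_seq (fun n => Cmod (u n)) 0%R.
Proof.
  split.
  - intros [H1 H2].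
    apply is_lim_seq_le_le with (fun _ => 0%R)
      (fun n => (Rabs (Re (u n)) + Rabs (Im (u n)))%R).
    + intros n; split; [apply Cmod_ge_0 |].
      rewrite <- (Cmod_R (Re (u n))), <- (Cmod_R (Im (u n))).
      replace (Cmod (Im (u n))) with (Cmod (Ci * Im (u n))).
      2: { rewrite Cmod_mult; replace (Cmod Ci) with 1%R; [ring |].
           unfold Cmod, Ci; simpl. replace (_ + _)%R with 1%R by ring.
           now rewrite sqrt_1. }
      eapply Rle_trans; [| apply Cmod_triangle].
      right; f_equal; apply C_eq; simpl; ring.
    + apply is_lim_seq_const.
    + replace 0%R with (Rabs (Re 0) + Rabs (Im 0))%R
        by (simpl; rewrite Rabs_R0; ring).
      apply is_lim_seq_plus'; now apply (is_lim_seq_abs _ (Finite _)).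
  - intros H; split; apply is_lim_seq_abs_0;
      apply is_lim_seq_le_le with (fun _ => 0%R) (fun n => Cmod (u n));
      try apply is_lim_seq_const; try assumption; intros n; split;
      try apply Rabs_pos.
    + eapply Rle_trans; [| apply Rmax_Cmod]; apply Rmax_l.
    + eapply Rle_trans; [| apply Rmax_Cmod]; apply Rmax_r.
Qed.

Lemma is_Clim_0_le u (r : nat -> R) :
  eventually (fun n => (Cmod (u n) <= r n)%R) -> is_lim_seq r 0%R -> is_Clim u 0.
Proof.
  intros Hle Hr; apply is_Clim_0_Cmod.
  apply is_lim_seq_le_le_loc with (fun _ => 0%R) r; try assumption.
  - destruct Hle as [N HN]; exists N; intros n Hn; split; auto; apply Cmod_ge_0.
  - apply is_lim_seq_const.
Qed.

Lemma csum_Re u n : sum_n (fun k => Re (u k)) n = Re (csum u (S n)).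
Proof.
  induction n as [|n IH]; [rewrite sum_O; unfold Re, Im; simpl; ring |].
  rewrite sum_Sn, IH; reflexivity.
Qed.

Lemma csum_Im u n : sum_n (fun k => Im (u k)) n = Im (csum u (S n)).
Proof.
  induction n as [|n IH]; [rewrite sum_O; unfold Re, Im; simpl; ring |].
  rewrite sum_Sn, IH; reflexivity.
Qed.

Lemma is_Clim_csum u l :
  is_Clim (csum u) l <->
  is_series (fun k => Re (u k)) (Re l) /\ is_series (fun k => Im (u k)) (Im l).
Proof.
  rewrite <- is_Clim_incr.
  assert (H1 : is_series (fun k => Re (u k)) (Re l) <->
    is_lim_seq (fun n => Re (csum u (S n))) (Re l)).
  { change (is_lim_seq (sum_n (fun k => Re (u k))) (Re l) <->
      is_lim_seq (fun n => Re (csum u (S n))) (Re l)).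
    split; apply is_lim_seq_ext; intros n; now rewrite csum_Re. }
  assert (H2 : is_series (fun k => Im (u k)) (Im l) <->
    is_lim_seq (fun n => Im (csum u (S n))) (Im l)).
  { change (is_lim_seq (sum_n (fun k => Im (u k))) (Im l) <->
      is_lim_seq (fun n => Im (csum u (S n))) (Im l)).
    split; apply is_lim_seq_ext; intros n; now rewrite csum_Im. }
  rewrite H1, H2; reflexivity.
Qed.

Lemma is_Clim_Cseries u l : is_Clim (csum u) l -> Cseries u = l.
Proof.
  rewrite is_Clim_csum; intros [H1 H2]; unfold Cseries.
  rewrite (is_series_unique _ _ H1), (is_series_unique _ _ H2); now apply C_eq.
Qed.

Lemma sum_n_csum (u : nat -> C) n :
  @sum_n C_AbelianMonoid u n = csum u (S n).
Proof.
  induction n as [|n IH].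
  - rewrite sum_O; simpl; now rewrite Cplus_0_l.
  - rewrite sum_Sn, IH; reflexivity.
Qed.

Lemma ex_Cseries_is_Clim u : ex_Cseries u -> is_Clim (csum u) (Cseries u).
Proof.
  intros [l Hl].
  assert (H : is_Clim (csum u) l).
  { rewrite is_Clim_csum; split; apply filterlim_locally; intros eps;
      destruct (proj1 (filterlim_locally _ _) Hl eps) as [N HN];
      exists N; intros n Hn; destruct (HN n Hn) as [H1 H2].
    - rewrite csum_Re; rewrite sum_n_csum in H1; exact H1.
    - rewrite csum_Im; rewrite sum_n_csum in H2; exact H2. }
  now rewrite (is_Clim_Cseries _ _ H).
Qed.

Lemma is_Clim_subseq u l (phi : nat -> nat) :
  (forall n, (n <= phi n)%nat) -> is_Clim u l -> is_Clim (fun n => u (phi n)) l.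
Proof.
  intros Hphi [H1 H2].
  assert (Hf : filterlim phi eventually eventually).
  { intros P [N HN]; exists N; intros n Hn; apply HN.
    specialize (Hphi n); lia. }
  split; [apply (is_lim_seq_subseq (fun n => Re (u n)) _ phi)
         | apply (is_lim_seq_subseq (fun n => Im (u n)) _ phi)]; assumption.
Qed.

Lemma Cmod_le_add (z w : C) : (Cmod z <= Cmod w + Cmod (z - w))%R.
Proof.
  replace z with (w + (z - w)) at 1 by ring. apply Cmod_triangle.
Qed.

Lemma is_Clim_bounded u l : is_Clim u l -> exists A, forall n, (Cmod (u n) <= A)%R.
Proof.
  intros H.
  assert (Hd : is_Clim (fun n => u n + (-1) * l) 0).
  { replace (RtoC 0) with (l + (-1) * l) by ring.
    apply is_Clim_plus; [assumption | apply is_Clim_const]. }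
  apply is_Clim_0_Cmod in Hd. apply is_lim_seq_Reals in Hd.
  destruct (maj_by_pos _ (exist _ _ Hd)) as [A [_ HA]].
  exists (Cmod l + A)%R; intros n. specialize (HA n).
  rewrite Rabs_pos_eq in HA by apply Cmod_ge_0.
  eapply Rle_trans; [apply (Cmod_le_add _ l) |].
  apply Rplus_le_compat_l. replace (u n - l) with (u n + (-1) * l) by ring. exact HA.
Qed.

Lemma csum_ext u v n : (forall k, u k = v k) -> csum u n = csum v n.
Proof. intros H; induction n as [|n IH]; simpl; [reflexivity | now rewrite IH, H]. Qed.

Lemma csum_shift u n : csum u (S n) = u O + csum (fun k => u (S k)) n.
Proof.
  induction n as [|n IH]; [simpl; ring |].
  change (csum u (S (S n))) with (csum u (S n) + u (S n)). rewrite IH. simpl; ring.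
Qed.

(** * Terms of a convergent slowly varying series *)

(** If the relative increments of [x] are [O(1/k)], then [x] moves away from [x N]
    by at most half of its size on a block of length proportional to [N]; a block of
    the series is then comparable with [N * x N], and the Cauchy criterion makes
    [N * x N] small.  This replaces the asymptotics
    [k ^ (a + c - e - 1)] of hypergeometric terms: it needs no gamma function, no
    absolute convergence, and no separate treatment of terminating series. *)
Section SlowVariation.

Variables (x : nat -> C) (K N0 : nat).
Hypothesis HK : (1 <= K)%nat.
Hypothesis Hx : forall k, (N0 <= k)%nat ->
  (INR (S k) * Cmod (x (S k) - x k) <= INR K * Cmod (x k))%R.

(** The total drift over [j] steps is at most twice the sum of the first-order
    increments [K / N], as long as [x] has not yet doubled. *)
Lemma slow_variation_drift N j :
  (N0 <= N)%nat -> (1 <= N)%nat -> (4 * K * j <= N)%nat ->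
  (INR N * Cmod (x (N + j)%nat - x N) <= 2 * INR K * INR j * Cmod (x N))%R.
Proof.
  intros HN0 HN1; induction j as [|j IH]; intros Hj.
  - rewrite Nat.add_0_r. replace (x N - x N) with (RtoC 0) by ring.
    rewrite Cmod_0; simpl; lra.
  - specialize (IH ltac:(nia)).
    assert (Hj' : (4 * INR K * INR j <= INR N)%R).
    { replace 4%R with (INR 4) by (simpl; ring). rewrite <- !mult_INR.
      apply le_INR; nia. }
    pose proof (Hx (N + j) ltac:(lia)) as Hs.
    rewrite Nat.add_succ_r.
    set (d := x (S (N + j)) - x (N + j)%nat) in *.
    set (D := x (N + j)%nat - x N) in *.
    assert (Ht : (Cmod (x (S (N + j)) - x N) <= Cmod d + Cmod D)%R).
    { replace (x (S (N + j)) - x N) with (d + D) by (unfold d, D; ring).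
      apply Cmod_triangle. }
    pose proof (Cmod_le_add (x (N + j)%nat) (x N)) as Hm; fold D in Hm.
    pose proof (Cmod_ge_0 d) as Hd. pose proof (Cmod_ge_0 D).
    pose proof (Cmod_ge_0 (x N)) as HxN.
    assert (HNp : (1 <= INR N)%R) by (apply (le_INR 1); lia).
    assert (HKp : (1 <= INR K)%R) by (apply (le_INR 1); lia).
    assert (Hle : (INR N <= INR (S (N + j)))%R) by (apply le_INR; lia).
    rewrite S_INR.
    assert (HD : (Cmod D <= Cmod (x N))%R).
    { apply Rmult_le_reg_l with (INR N); [lra |].
      eapply Rle_trans; [exact IH |]. apply Rmult_le_compat_r; lra. }
    assert (Hd2 : (INR N * Cmod d <= INR K * (2 * Cmod (x N)))%R).
    { eapply Rle_trans; [apply Rmult_le_compat_r; [lra | exact Hle] |].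
      eapply Rle_trans; [exact Hs |]. apply Rmult_le_compat_l; lra. }
    assert (INR N * Cmod (x (S (N + j)) - x N) <= INR N * (Cmod d + Cmod D))%R
      by (apply Rmult_le_compat_l; lra).
    lra.
Qed.

Lemma slow_variation_block N J :
  (N0 <= N)%nat -> (1 <= N)%nat -> (4 * K * J <= N)%nat ->
  (INR J * Cmod (x N) <= 2 * Cmod (csum x (N + J) - csum x N))%R.
Proof.
  intros HN0 HN1 HJ.
  assert (HNp : (1 <= INR N)%R) by (apply (le_INR 1); lia).
  assert (H : forall j, (j <= J)%nat ->
    (Cmod (csum x (N + j) - csum x N - INR j * x N) <= INR j / 2 * Cmod (x N))%R).
  { induction j as [|j IH]; intros Hj.
    - rewrite Nat.add_0_r. simpl INR.
      replace (csum x N - csum x N - 0 * x N) with (RtoC 0) by ring.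
      rewrite Cmod_0; lra.
    - specialize (IH ltac:(lia)). rewrite Nat.add_succ_r, S_INR, RtoC_plus.
      simpl csum.
      replace (csum x (N + j) + x (N + j)%nat - csum x N - (INR j + 1) * x N)
        with ((csum x (N + j) - csum x N - INR j * x N) + (x (N + j)%nat - x N))
        by ring.
      eapply Rle_trans; [apply Cmod_triangle |].
      pose proof (slow_variation_drift N j HN0 HN1 ltac:(nia)) as Hd.
      assert (Hj' : (4 * INR K * INR j <= INR N)%R).
      { replace 4%R with (INR 4) by (simpl; ring). rewrite <- !mult_INR.
        apply le_INR; nia. }
      assert (Cmod (x (N + j)%nat - x N) <= / 2 * Cmod (x N))%R.
      { apply Rmult_le_reg_l with (INR N); [lra |].
        eapply Rle_trans; [exact Hd |]. rewrite <- Rmult_assoc.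
        apply Rmult_le_compat_r; [apply Cmod_ge_0 | lra]. }
      lra. }
  specialize (H J (Nat.le_refl _)).
  pose proof (Cmod_le_add (INR J * x N) (csum x (N + J) - csum x N)) as Ht.
  replace (INR J * x N - (csum x (N + J) - csum x N))
    with (- (csum x (N + J) - csum x N - INR J * x N)) in Ht by ring.
  rewrite Cmod_opp, Cmod_mult, Cmod_R, Rabs_pos_eq in Ht by apply pos_INR.
  lra.
Qed.

Lemma slow_variation_summable l :
  is_Clim (csum x) l -> is_Clim (fun k => INR k * x k) 0.
Proof.
  intros Hl.
  assert (Hdiff : is_Clim (fun N => csum x (N + N / (4 * K)) - csum x N) 0).
  { replace (RtoC 0) with (l + (-1) * l) by ring.
    apply is_Clim_ext with
      (fun N => csum x (N + N / (4 * K)) + (-1) * csum x N); [intros; ring |].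
    apply is_Clim_plus; [| now apply is_Clim_scal].
    apply (is_Clim_subseq (csum x) l (fun N => (N + N / (4 * K))%nat));
      [intros; lia | assumption]. }
  apply is_Clim_0_Cmod in Hdiff.
  (* With [J = N / (4 K)] one has [N <= 8 K J] once [J >= 1], and the block lemma
     loses another factor 2. *)
  apply is_Clim_0_le with
    (fun N => (16 * INR K * Cmod (csum x (N + N / (4 * K)) - csum x N))%R).
  - exists (N0 + 4 * K)%nat; intros N HN.
    pose proof (Nat.div_mod N (4 * K) ltac:(lia)) as Hdm.
    pose proof (Nat.mod_upper_bound N (4 * K) ltac:(lia)) as Hmod.
    set (J := (N / (4 * K))%nat) in *.
    pose proof (slow_variation_block N J ltac:(lia) ltac:(lia) ltac:(nia)) as Hb.
    rewrite Cmod_mult, Cmod_R, Rabs_pos_eq by apply pos_INR.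
    assert (HNJ : (INR N <= 8 * INR K * INR J)%R).
    { replace 8%R with (INR 8) by (simpl; ring). rewrite <- !mult_INR.
      apply le_INR. assert (1 <= J)%nat by nia. nia. }
    apply Rle_trans with (8 * INR K * (INR J * Cmod (x N)))%R.
    + rewrite <- Rmult_assoc. apply Rmult_le_compat_r; [apply Cmod_ge_0 | assumption].
    + replace (16 * INR K * Cmod (csum x (N + J) - csum x N))%R
        with (8 * INR K * (2 * Cmod (csum x (N + J) - csum x N)))%R by ring.
      apply Rmult_le_compat_l; [| assumption].
      pose proof (pos_INR K); lra.
  - replace 0%R with (16 * INR K * 0)%R by ring.
    apply is_lim_seq_mult'; [apply is_lim_seq_const | assumption].
Qed.

End SlowVariation.

Local Open Scope R_scope.

(** * Series of real functions with quadratic decay *)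

(** The reference summable sequence: unlike [1 / n ^ 2], its partial sums and tails
    telescope, so they are explicit. *)
Definition inv_pronic (n : nat) : R := / ((INR n + 1) * (INR n + 2)).

Lemma inv_pronic_pos n : 0 < inv_pronic n.
Proof. apply Rinv_0_lt_compat. pose proof (pos_INR n). nra. Qed.

Lemma inv_pronic_telescope n : inv_pronic n = / (INR n + 1) - / (INR (S n) + 1).
Proof. unfold inv_pronic; rewrite S_INR. pose proof (pos_INR n). field; lra. Qed.

(** Term-by-term differentiation under a summable bound.  The initial term [f0] is
    kept apart because the logarithm of the first gamma approximant is not
    bounded near [x = 0]. *)
Section SeriesDerive.

Variables (X K : R) (f0 df0 : R -> R) (g dg : nat -> R -> R).
Hypothesis HK : 0 <= K.
Let D (x : R) := 0 < x < X.
Hypothesis Hf0 : forall x, D x -> is_derive f0 x (df0 x).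
Hypothesis Hdf0 : forall x, D x -> continuity_pt df0 x.
Hypothesis Hg : forall n x, D x -> is_derive (g n) x (dg n x).
Hypothesis Hdg : forall n x, D x -> continuity_pt (dg n) x.
Hypothesis Bg : forall n x, D x -> Rabs (g n x) <= K * inv_pronic n.
Hypothesis Bdg : forall n x, D x -> Rabs (dg n x) <= K * inv_pronic n.

Fixpoint fsum (h0 : R -> R) (h : nat -> R -> R) (n : nat) (x : R) : R :=
  match n with
  | O => h0 x
  | S m => fsum h0 h m x + h m x
  end.

Lemma fsum_tail h0 h (x : R) (Bh : forall n, Rabs (h n x) <= K * inv_pronic n) N k :
  Rabs (fsum h0 h (N + k) x - fsum h0 h N x)
    <= K * (/ (INR N + 1) - / (INR (N + k) + 1)).
Proof.
  induction k as [|k IH].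
  - rewrite Nat.add_0_r, Rminus_eq_0, Rabs_R0; lra.
  - rewrite Nat.add_succ_r; simpl fsum.
    specialize (Bh (N + k)%nat); rewrite inv_pronic_telescope in Bh.
    replace (fsum h0 h (N + k) x + h (N + k)%nat x - fsum h0 h N x)
      with ((fsum h0 h (N + k) x - fsum h0 h N x) + h (N + k)%nat x) by ring.
    eapply Rle_trans; [apply Rabs_triang |]. lra.
Qed.

Lemma fsum_CVU h0 h :
  (forall n x, D x -> Rabs (h n x) <= K * inv_pronic n) -> CVU_dom (fsum h0 h) D.
Proof.
  intros Bh; apply CVU_dom_cauchy; intros eps.
  destruct (nfloor_ex (2 * K / eps)) as [N [_ HN]].
  { apply Rmult_le_pos; [lra | left; apply Rinv_0_lt_compat, cond_pos]. }
  exists N; intros n m x Dx Hn Hm.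
  pose proof (cond_pos eps) as He.
  pose proof (pos_INR N) as HNp.
  assert (Hb : K * / (INR N + 1) < eps / 2).
  { apply Rmult_lt_reg_r with (INR N + 1); [lra |].
    rewrite Rmult_assoc, Rinv_l by lra.
    apply (Rmult_lt_compat_r eps) in HN; [| lra].
    unfold Rdiv in HN; rewrite Rmult_assoc, Rinv_l in HN by lra. lra. }
  assert (Ht : forall p, (N <= p)%nat ->
    Rabs (fsum h0 h p x - fsum h0 h N x) < eps / 2).
  { intros p Hp; replace p with (N + (p - N))%nat by lia.
    eapply Rle_lt_trans; [apply fsum_tail; intros; now apply Bh |].
    assert (0 < / (INR (N + (p - N)) + 1)).
    { apply Rinv_0_lt_compat. pose proof (pos_INR (N + (p - N))). lra. }
    nra. }
  replace (fsum h0 h n x - fsum h0 h m x)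
    with ((fsum h0 h n x - fsum h0 h N x) - (fsum h0 h m x - fsum h0 h N x)) by ring.
  eapply Rle_lt_trans; [apply Rabs_triang |]. rewrite Rabs_Ropp.
  pose proof (Ht n Hn). pose proof (Ht m Hm). lra.
Qed.

Lemma fsum_lim h0 h x :
  (forall n x, D x -> Rabs (h n x) <= K * inv_pronic n) -> D x ->
  is_lim_seq (fun n => fsum h0 h n x) (real (Lim_seq (fun n => fsum h0 h n x))).
Proof.
  intros Bh Dx; apply is_lim_seq_spec; intros eps.
  destruct (fsum_CVU h0 h Bh eps) as [N HN]; exists N; intros n Hn.
  now apply HN.
Qed.

Lemma D_open : open D.
Proof. apply open_and; [apply open_gt | apply open_lt]. Qed.

Lemma fsum_derive n x : D x -> is_derive (fsum f0 g n) x (fsum df0 dg n x).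
Proof.
  intros Dx; induction n as [|n IH]; [now apply Hf0 |].
  simpl. apply (is_derive_plus (fsum f0 g n) (g n)); auto.
Qed.

Lemma fsum_continuous n x : D x -> continuity_pt (fsum df0 dg n) x.
Proof.
  intros Dx; induction n as [|n IH]; [now apply Hdf0 |].
  simpl. apply (continuity_pt_plus (fsum df0 dg n) (dg n)); auto.
Qed.

Lemma series_ex_derive x :
  D x -> ex_derive (fun t => real (Lim_seq (fun n => fsum f0 g n t))) x.
Proof.
  intros Dx.
  assert (HD : forall n t, D t -> Derive (fsum f0 g n) t = fsum df0 dg n t).
  { intros n t Dt; now apply is_derive_unique, fsum_derive. }
  eexists; apply (CVU_Derive (fsum f0 g) D).
  - apply D_open.
  - intros u v w [H1 H2] [H3 H4] [H5 H6]; split; lra.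
  - now apply fsum_CVU.
  - intros n t Dt; eexists; now apply fsum_derive.
  - intros n t Dt. apply continuity_pt_ext_loc with (fsum df0 dg n).
    + apply filter_imp with (2 := D_open t Dt). intros s Ds; now rewrite HD.
    + now apply fsum_continuous.
  - apply CVU_dom_cauchy. intros eps.
    destruct (proj1 (CVU_dom_cauchy _ _) (fsum_CVU df0 dg Bdg) eps) as [N HN].
    exists N; intros n m t Dt Hn Hm. rewrite !HD by assumption. now apply HN.
  - assumption.
Qed.

End SeriesDerive.

Lemma MVT_bound f df B a b :
  (forall t, Rmin a b <= t <= Rmax a b -> is_derive f t (df t)) ->
  (forall t, Rmin a b <= t <= Rmax a b -> Rabs (df t) <= B) ->
  Rabs (f b - f a) <= B * Rabs (b - a).
Proof.
  intros Hd HB. destruct (MVT_gen f a b df) as [t [Ht ->]].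
  - intros t Ht; apply Hd; lra.
  - intros t Ht; apply continuity_pt_filterlim.
    apply (ex_derive_continuous f t); eexists; now apply Hd.
  - rewrite Rabs_mult. apply Rmult_le_compat_r; [apply Rabs_pos | now apply HB].
Qed.

(** * Logarithm of Gauss's approximants in the right half-plane *)

(** Real and imaginary part of the principal logarithm of [x + i y] for [x > 0];
    [y] comes first because the functions of [x] are the ones differentiated
    in the limit. *)
Definition clogR (y x : R) : R := ln (x ^ 2 + y ^ 2) / 2.
Definition clogI (y x : R) : R := atan (y / x).

Lemma clogR_derive_x y x : 0 < x ->
  is_derive (clogR y) x (x / (x ^ 2 + y ^ 2)).
Proof.
  intros Hx; unfold clogR; auto_derive; [nra | field; nra].
Qed.

Lemma clogI_derive_x y x : 0 < x ->
  is_derive (clogI y) x (- (y / (x ^ 2 + y ^ 2))).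
Proof.
  intros Hx; unfold clogI; auto_derive; [lra |].
  unfold Rsqr. field; split; nra.
Qed.

Lemma clogR_derive_y y x : 0 < x ->
  is_derive (fun t => clogR t x) y (y / (x ^ 2 + y ^ 2)).
Proof.
  intros Hx; unfold clogR; auto_derive; [nra | field; nra].
Qed.

Lemma clogI_derive_y y x : 0 < x ->
  is_derive (fun t => clogI t x) y (x / (x ^ 2 + y ^ 2)).
Proof.
  intros Hx; unfold clogI; auto_derive; [lra |].
  unfold Rsqr. field; split; nra.
Qed.

(** [stepR + i stepI] is the logarithm of the quotient of two consecutive Gauss
    approximants, [(n+2) * ((n+2)/(n+1))^z / (z+n+2)]. *)
Definition stepR (y : R) (n : nat) (x : R) : R :=
  ln (INR n + 2) + x * (ln (INR n + 2) - ln (INR n + 1)) - clogR y (x + (INR n + 2)).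
Definition stepI (y : R) (n : nat) (x : R) : R :=
  y * (ln (INR n + 2) - ln (INR n + 1)) - clogI y (x + (INR n + 2)).
Definition dstepR (y : R) (n : nat) (x : R) : R :=
  ln (INR n + 2) - ln (INR n + 1)
    - (x + (INR n + 2)) / ((x + (INR n + 2)) ^ 2 + y ^ 2).
Definition dstepI (y : R) (n : nat) (x : R) : R :=
  y / ((x + (INR n + 2)) ^ 2 + y ^ 2).

Lemma is_derive_shift (f : R -> R) (x a l : R) : is_derive f (x + a) l -> is_derive (fun t => f (t + a)) x l.
Proof.
  intros H. replace l with (scal 1 l) by apply (Rmult_1_l l).
  apply (is_derive_comp f (fun t => t + a)); [exact H | auto_derive; [trivial | ring]].
Qed.

Lemma stepR_derive_x y n x : 0 <= x -> is_derive (stepR y n) x (dstepR y n x).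
Proof.
  intros Hx; pose proof (pos_INR n). unfold stepR, dstepR.
  apply (is_derive_minus (fun x => ln (INR n + 2) + x * (ln (INR n + 2) - ln (INR n + 1)))
    (fun x => clogR y (x + (INR n + 2)))).
  - auto_derive; [trivial | ring].
  - apply is_derive_shift. apply clogR_derive_x; lra.
Qed.

Lemma stepI_derive_x y n x : 0 <= x -> is_derive (stepI y n) x (dstepI y n x).
Proof.
  intros Hx; pose proof (pos_INR n). unfold stepI, dstepI.
  replace (y / ((x + (INR n + 2)) ^ 2 + y ^ 2))
    with (minus 0 (- (y / ((x + (INR n + 2)) ^ 2 + y ^ 2))))
    by (unfold minus, plus, opp; simpl; ring).
  apply (is_derive_minus (fun x => y * (ln (INR n + 2) - ln (INR n + 1)))
    (fun x => clogI y (x + (INR n + 2)))).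
  - auto_derive; [trivial | ring].
  - apply is_derive_shift. apply clogI_derive_x; lra.
Qed.

Lemma stepR_derive_y y n x : 0 <= x ->
  is_derive (fun y => stepR y n x) y (- dstepI y n x).
Proof.
  intros Hx; pose proof (pos_INR n). unfold stepR, dstepI.
  replace (- (y / ((x + (INR n + 2)) ^ 2 + y ^ 2)))
    with (minus 0 (y / ((x + (INR n + 2)) ^ 2 + y ^ 2)))
    by (unfold minus, plus, opp; simpl; ring).
  apply (is_derive_minus (fun y => ln (INR n + 2) + x * (ln (INR n + 2) - ln (INR n + 1)))
    (fun y => clogR y (x + (INR n + 2)))).
  - auto_derive; [trivial | ring].
  - apply clogR_derive_y; lra.
Qed.

(** By the Cauchy-Riemann equations the [y]-derivatives are, up to sign, the
    [x]-derivatives of the other component, so bounding [dstepR] and [dstepI]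
    controls the whole gradient. *)
Lemma stepI_derive_y y n x : 0 <= x ->
  is_derive (fun y => stepI y n x) y (dstepR y n x).
Proof.
  intros Hx; pose proof (pos_INR n). unfold stepI, dstepR.
  apply (is_derive_minus (fun y => y * (ln (INR n + 2) - ln (INR n + 1)))
    (fun y => clogI y (x + (INR n + 2)))).
  - auto_derive; [trivial | ring].
  - apply clogI_derive_y; lra.
Qed.

Lemma ln_le_sub1 t : 0 < t -> ln t <= t - 1.
Proof.
  intros Ht. pose proof (exp_ineq1_le (ln t)) as H. rewrite exp_ln in H by assumption. lra.
Qed.

Lemma ln_step p : 1 < p -> / p <= ln p - ln (p - 1) <= / (p - 1).
Proof.
  intros Hp. split.
  - pose proof (ln_le_sub1 ((p - 1) / p)) as H.
    unfold Rdiv in H; rewrite ln_mult, ln_Rinv in H;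
      [| lra | lra | apply Rinv_0_lt_compat; lra].
    assert (Hd : 0 < (p - 1) * / p) by (apply Rmult_lt_0_compat; [lra | apply Rinv_0_lt_compat; lra]).
    specialize (H Hd). replace ((p - 1) * / p - 1) with (- / p) in H by (field; lra). lra.
  - pose proof (ln_le_sub1 (p / (p - 1))) as H.
    unfold Rdiv in H; rewrite ln_mult, ln_Rinv in H;
      [| lra | lra | apply Rinv_0_lt_compat; lra].
    assert (Hd : 0 < p * / (p - 1)) by (apply Rmult_lt_0_compat; [lra | apply Rinv_0_lt_compat; lra]).
    specialize (H Hd). replace (p * / (p - 1) - 1) with (/ (p - 1)) in H by (field; lra). lra.
Qed.

Section Bounds.

Variables X Y : R.
Hypothesis HX : 0 <= X.
Hypothesis HY : 0 <= Y.
Let K := 1 + X + Y ^ 2 + Y.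

Lemma inv_sq_le_inv_pronic n : / (INR n + 2) ^ 2 <= inv_pronic n.
Proof.
  pose proof (pos_INR n). apply Rinv_le_contravar; nra.
Qed.

Lemma norm2_inv_le n x y : 0 <= x ->
  / ((x + (INR n + 2)) ^ 2 + y ^ 2) <= / (INR n + 2) ^ 2.
Proof. intros Hx; pose proof (pos_INR n). apply Rinv_le_contravar; nra. Qed.

Lemma dstepI_bound n x y :
  0 <= x -> Rabs y <= Y -> Rabs (dstepI y n x) <= K * inv_pronic n.
Proof.
  intros Hx Hy; pose proof (pos_INR n).
  unfold dstepI, Rdiv. rewrite Rabs_mult, (Rabs_pos_eq (/ _)).
  2: { left; apply Rinv_0_lt_compat; nra. }
  pose proof (norm2_inv_le n x y Hx). pose proof (inv_sq_le_inv_pronic n).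
  assert (0 < / ((x + (INR n + 2)) ^ 2 + y ^ 2)) by (apply Rinv_0_lt_compat; nra).
  apply Rmult_le_compat; try lra; [apply Rabs_pos |].
  unfold K; nra.
Qed.

(** The difference of logarithms lies between [1/p] and [1/(p-1)] with [p = n + 2], and the
    real part of [1/(z+p)] differs from [1/p] by [O(1/p^2)] on bounded sets. *)
Lemma dstepR_bound n x y :
  0 <= x <= X -> Rabs y <= Y -> Rabs (dstepR y n x) <= K * inv_pronic n.
Proof.
  intros [Hx0 Hx] Hy; pose proof (pos_INR n) as Hn.
  unfold dstepR. set (p := INR n + 2) in *.
  pose proof (ln_step p ltac:(unfold p; lra)) as [Hl1 Hl2].
  replace (p - 1) with (INR n + 1) in Hl1, Hl2 by (unfold p; ring).
  set (lam := ln p - ln (INR n + 1)) in *.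
  assert (Hq : inv_pronic n = / (INR n + 1) - / p).
  { unfold inv_pronic, p; field; lra. }
  assert (HN : 0 < (x + p) ^ 2 + y ^ 2) by (unfold p; nra).
  assert (Hp : 0 < p) by (unfold p; lra).
  assert (Hdiff : / p - (x + p) / ((x + p) ^ 2 + y ^ 2)
    = (x * (x + p) + y ^ 2) / p * / ((x + p) ^ 2 + y ^ 2)) by (field; lra).
  assert (Hy2 : y ^ 2 <= Y ^ 2).
  { rewrite <- (pow2_abs y). apply pow_incr; split; [apply Rabs_pos | lra]. }
  assert (H2 : 0 <= (x * (x + p) + y ^ 2) / p * / ((x + p) ^ 2 + y ^ 2) <= (X + Y ^ 2) * inv_pronic n).
  { split.
    - apply Rmult_le_pos; [apply Rmult_le_pos; [nra |] |]; left; now apply Rinv_0_lt_compat.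
    - apply Rle_trans with ((X + Y ^ 2) * / p ^ 2).
      2: { apply Rmult_le_compat_l; [nra | apply inv_sq_le_inv_pronic]. }
      apply Rmult_le_reg_r with (p ^ 2 * ((x + p) ^ 2 + y ^ 2)); [apply Rmult_lt_0_compat; nra |].
      replace (_ * (p ^ 2 * _)) with (p * (x * (x + p) + y ^ 2)) by (field; nra).
      replace ((X + Y ^ 2) * / p ^ 2 * (p ^ 2 * ((x + p) ^ 2 + y ^ 2)))
        with ((X + Y ^ 2) * ((x + p) ^ 2 + y ^ 2)) by (field; nra).
      assert (1 <= p) by (unfold p; lra).
      apply Rle_trans with ((X + Y ^ 2) * (x + p) ^ 2).
      + assert (x * (p * (x + p)) <= X * (x + p) ^ 2).
        { apply Rmult_le_compat; nra. }
        assert (y ^ 2 * p <= Y ^ 2 * (x + p) ^ 2).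
        { apply Rmult_le_compat; nra. }
        lra.
      + apply Rmult_le_compat_l; nra. }
  pose proof (inv_pronic_pos n).
  replace (lam - (x + p) / ((x + p) ^ 2 + y ^ 2))
    with ((lam - / p) + (/ p - (x + p) / ((x + p) ^ 2 + y ^ 2))) by ring.
  rewrite Hdiff. rewrite Rabs_pos_eq by lra.
  unfold K. assert (0 <= Y * inv_pronic n) by nra. lra.
Qed.

Lemma stepR_origin n : stepR 0 n 0 = 0.
Proof.
  pose proof (pos_INR n).
  unfold stepR, clogR. replace ((0 + (INR n + 2)) ^ 2 + 0 ^ 2) with ((INR n + 2) * (INR n + 2)) by ring.
  rewrite ln_mult by lra. field.
Qed.

Lemma stepI_origin n : stepI 0 n 0 = 0.
Proof.
  unfold stepI, clogI. replace (0 / (0 + (INR n + 2))) with 0 by (unfold Rdiv; ring).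
  rewrite atan_0. ring.
Qed.

(** The increments vanish at the origin, where the quotient [p / p] of consecutive
    approximants is 1, so a gradient bound gives a bound on the values: go up the
    imaginary axis, then right.  No expansion of [ln] or [atan] is needed. *)
Lemma step_bound (s : R -> nat -> R -> R) dx dy n :
  s 0 n 0 = 0 ->
  (forall y x, 0 <= x -> is_derive (s y n) x (dx y n x)) ->
  (forall y x, 0 <= x -> is_derive (fun y => s y n x) y (dy y n x)) ->
  (forall y x, 0 <= x <= X -> Rabs y <= Y -> Rabs (dx y n x) <= K * inv_pronic n) ->
  (forall y x, 0 <= x <= X -> Rabs y <= Y -> Rabs (dy y n x) <= K * inv_pronic n) ->
  forall y x, 0 <= x <= X -> Rabs y <= Y -> Rabs (s y n x) <= K * (X + Y) * inv_pronic n.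
Proof.
  intros H0 Hx Hy Bx By y x Dx Dy.
  assert (H1 : Rabs (s y n x - s y n 0) <= K * inv_pronic n * Rabs (x - 0)).
  { apply MVT_bound with (df := dx y n); rewrite Rmin_left, Rmax_right by lra;
      intros t Ht; [apply Hx | apply Bx]; try assumption; lra. }
  assert (H2 : Rabs (s y n 0 - s 0 n 0) <= K * inv_pronic n * Rabs (y - 0)).
  { apply (MVT_bound (fun y => s y n 0)) with (df := fun y => dy y n 0); intros t Ht.
    - apply Hy; lra.
    - apply By; [lra |]. eapply Rle_trans; [| exact Dy].
      revert Ht; unfold Rmin, Rmax, Rabs; destruct Rle_dec; destruct Rcase_abs; destruct Rcase_abs; lra. }
  pose proof (inv_pronic_pos n). assert (0 < K) by (unfold K; nra).
  assert (HKq : 0 <= K * inv_pronic n) by nra.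
  rewrite H0, !Rminus_0_r in *. rewrite (Rabs_pos_eq x) in H1 by lra.
  replace (s y n x) with ((s y n x - s y n 0) + s y n 0) by ring.
  eapply Rle_trans; [apply Rabs_triang |].
  assert (K * inv_pronic n * x <= K * inv_pronic n * X) by (apply Rmult_le_compat_l; lra).
  assert (K * inv_pronic n * Rabs y <= K * inv_pronic n * Y) by (apply Rmult_le_compat_l; lra).
  lra.
Qed.

Lemma stepR_bound n y x :
  0 <= x <= X -> Rabs y <= Y -> Rabs (stepR y n x) <= K * (X + Y) * inv_pronic n.
Proof.
  apply (step_bound stepR dstepR (fun y n x => - dstepI y n x) n (stepR_origin n)).
  - intros; now apply stepR_derive_x.
  - intros; now apply stepR_derive_y.
  - intros; now apply dstepR_bound.
  - intros; rewrite Rabs_Ropp; now apply dstepI_bound.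
Qed.

Lemma stepI_bound n y x :
  0 <= x <= X -> Rabs y <= Y -> Rabs (stepI y n x) <= K * (X + Y) * inv_pronic n.
Proof.
  apply (step_bound stepI dstepI dstepR n (stepI_origin n)).
  - intros; now apply stepI_derive_x.
  - intros; now apply stepI_derive_y.
  - intros; now apply dstepI_bound.
  - intros; now apply dstepR_bound.
Qed.

End Bounds.

(** Logarithm of the approximant of index 1, [1 / (z (z+1))]. *)
Definition initR (y x : R) : R := - clogR y x - clogR y (x + 1).
Definition initI (y x : R) : R := - clogI y x - clogI y (x + 1).

(** Index [n] stands for the Gauss approximant of index [n + 1]: the one of index 0
    involves [ln 0]. *)
Definition log_gaussR (y : R) (n : nat) (x : R) : R := fsum (initR y) (stepR y) n x.
Definition log_gaussI (y : R) (n : nat) (x : R) : R := fsum (initI y) (stepI y) n x.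

Definition log_GammaR (y x : R) : R := real (Lim_seq (fun n => log_gaussR y n x)).
Definition log_GammaI (y x : R) : R := real (Lim_seq (fun n => log_gaussI y n x)).

Lemma ex_derive_cont f x : ex_derive f x -> continuity_pt f x.
Proof. intros H; apply continuity_pt_filterlim; now apply (ex_derive_continuous f x). Qed.

Lemma dstepR_cont y n x : 0 < x -> continuity_pt (dstepR y n) x.
Proof.
  intros Hx; apply ex_derive_cont. pose proof (pos_INR n). unfold dstepR; auto_derive; nra.
Qed.
Lemma dstepI_cont y n x : 0 < x -> continuity_pt (dstepI y n) x.
Proof.
  intros Hx; apply ex_derive_cont. pose proof (pos_INR n). unfold dstepI; auto_derive; nra.
Qed.

Lemma log_Gamma_spec y x : 0 < x ->
  (is_lim_seq (fun n => log_gaussR y n x) (log_GammaR y x) /\ ex_derive (log_GammaR y) x) /\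
  (is_lim_seq (fun n => log_gaussI y n x) (log_GammaI y x) /\ ex_derive (log_GammaI y) x).
Proof.
  intros Hx.
  set (X := x + 1); set (Y := Rabs y).
  assert (HX : 0 <= X) by (unfold X; lra).
  assert (HY : 0 <= Y) by apply Rabs_pos.
  set (K := (1 + X + Y ^ 2 + Y)).
  assert (HK1 : 0 < K) by (unfold K; nra).
  assert (HK : 0 <= K * (1 + X + Y)) by nra.
  assert (W : forall n t, Rabs t <= K * (X + Y) * inv_pronic n \/ Rabs t <= K * inv_pronic n ->
    Rabs t <= K * (1 + X + Y) * inv_pronic n).
  { intros n t. pose proof (inv_pronic_pos n).
    assert (0 <= K * inv_pronic n) by nra. assert (0 <= K * (X + Y) * inv_pronic n) by nra.
    intros [Hb | Hb]; lra. }
  assert (Dx : 0 < x < X) by (unfold X; lra).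
  split; split.
  - apply (fsum_lim X (K * (1 + X + Y))); try assumption.
    intros n t [Ht1 Ht2]; apply W; left; apply stepR_bound; try assumption; unfold Y; lra.
  - apply (series_ex_derive X (K * (1 + X + Y)) (initR y)
      (fun x => - (x / (x ^ 2 + y ^ 2)) - ((x + 1) / ((x + 1) ^ 2 + y ^ 2)))
      (stepR y) (dstepR y)); try assumption.
    + intros t [Ht1 Ht2]. unfold initR.
      apply (is_derive_minus (fun t => - clogR y t) (fun t => clogR y (t + 1))).
      * apply (is_derive_opp (clogR y)). apply clogR_derive_x; lra.
      * apply is_derive_shift, clogR_derive_x; lra.
    + intros t [Ht1 Ht2]; apply ex_derive_cont; auto_derive; nra.
    + intros n t [Ht1 Ht2]; apply stepR_derive_x; lra.
    + intros n t [Ht1 Ht2]; apply dstepR_cont; lra.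
    + intros n t [Ht1 Ht2]; apply W; left; apply stepR_bound; try assumption; unfold Y; lra.
    + intros n t [Ht1 Ht2]; apply W; right; apply dstepR_bound; try assumption; unfold Y; lra.
  - apply (fsum_lim X (K * (1 + X + Y))); try assumption.
    intros n t [Ht1 Ht2]; apply W; left; apply stepI_bound; try assumption; unfold Y; lra.
  - apply (series_ex_derive X (K * (1 + X + Y)) (initI y)
      (fun x => - - (y / (x ^ 2 + y ^ 2)) - (- (y / ((x + 1) ^ 2 + y ^ 2))))
      (stepI y) (dstepI y)); try assumption.
    + intros t [Ht1 Ht2]. unfold initI.
      apply (is_derive_minus (fun t => - clogI y t) (fun t => clogI y (t + 1))).
      * apply (is_derive_opp (clogI y)). apply clogI_derive_x; lra.
      * apply is_derive_shift, clogI_derive_x; lra.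
    + intros t [Ht1 Ht2]; apply ex_derive_cont; auto_derive; nra.
    + intros n t [Ht1 Ht2]; apply stepI_derive_x; lra.
    + intros n t [Ht1 Ht2]; apply dstepI_cont; lra.
    + intros n t [Ht1 Ht2]; apply W; left; apply stepI_bound; try assumption; unfold Y; lra.
    + intros n t [Ht1 Ht2]; apply W; right; apply dstepI_bound; try assumption; unfold Y; lra.
Qed.

Local Open Scope C_scope.

(** * The gamma function *)

Lemma Cexp_plus z w : Cexp (z + w) = Cexp z * Cexp w.
Proof.
  destruct z as [x y], w as [s t]; unfold Cexp; simpl.
  rewrite exp_plus, cos_plus, sin_plus. apply C_eq; simpl; ring.
Qed.

Lemma Cexp_0 : Cexp 0 = 1.
Proof. unfold Cexp; simpl. rewrite exp_0, cos_0, sin_0. apply C_eq; simpl; ring. Qed.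

Lemma Cexp_neq_0 z : Cexp z <> 0.
Proof.
  intros H. apply C1_nz. rewrite <- Cexp_0. replace (RtoC 0) with (z + - z) by ring.
  rewrite Cexp_plus, H. ring.
Qed.

Lemma Cexp_opp z : Cexp (- z) = / Cexp z.
Proof.
  assert (H : Cexp z * Cexp (- z) = 1).
  { rewrite <- Cexp_plus, <- Cexp_0. f_equal; ring. }
  pose proof (Cexp_neq_0 z). replace (Cexp (-z)) with (/ Cexp z * (Cexp z * Cexp (-z))) by (field; assumption).
  rewrite H; field; assumption.
Qed.

Lemma Cexp_RtoC r : Cexp (RtoC r) = RtoC (exp r).
Proof. unfold Cexp; simpl. rewrite cos_0, sin_0. apply C_eq; simpl; ring. Qed.

Lemma is_Clim_Cexp u l : is_Clim u l -> is_Clim (fun n => Cexp (u n)) (Cexp l).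
Proof.
  intros [H1 H2].
  assert (He := is_lim_seq_continuous exp _ _ (derivable_continuous_pt _ _ (derivable_pt_exp _)) H1).
  assert (Hc := is_lim_seq_continuous cos _ _ (continuity_cos _) H2).
  assert (Hs := is_lim_seq_continuous sin _ _ (continuity_sin _) H2).
  apply (is_Clim_mult (fun n => RtoC (exp (Re (u n))))
    (fun n => (cos (Im (u n)), sin (Im (u n))))).
  - split; simpl; [assumption | apply is_lim_seq_const].
  - split; assumption.
Qed.

Lemma Cexp_clog (x y : R) : (0 < x)%R -> Cexp (clogR y x, clogI y x) = (x, y).
Proof.
  intros Hx; unfold Cexp, clogR, clogI; simpl.
  rewrite cos_atan, sin_atan.
  set (N := (x * (x * 1) + y * (y * 1))%R).
  assert (HN : (0 < N)%R) by (unfold N; nra).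
  pose proof (sqrt_lt_R0 N HN) as Hs.
  assert (Hexp : exp (ln N / 2) = sqrt N).
  { rewrite <- (sqrt_sqrt N) at 1 by lra. rewrite ln_mult by assumption.
    replace ((ln (sqrt N) + ln (sqrt N)) / 2)%R with (ln (sqrt N)) by field.
    now apply exp_ln. }
  assert (Hn : sqrt (1 + (y / x)²) = (sqrt N / x)%R).
  { replace (1 + (y / x)²)%R with (N / (x * x))%R by (unfold N, Rsqr; field; lra).
    rewrite sqrt_div_alt by nra. rewrite sqrt_square by lra. reflexivity. }
  rewrite Hexp, Hn. apply C_eq; simpl; field; lra.
Qed.

Definition gauss_approx (z : C) (n : nat) : C :=
  INR (fact n) * Cexp (z * ln (INR n)) / poch z (S n).

Lemma INR_fact_neq_0_C n : RtoC (INR (fact n)) <> 0.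
Proof. intros H; apply RtoC_inj in H; now apply (INR_fact_neq_0 n). Qed.

Lemma RtoC_S n : RtoC (INR (S n)) = INR n + 1.
Proof. now rewrite S_INR, RtoC_plus. Qed.

Lemma RtoC_S_neq_0 n : RtoC (INR n) + 1 <> 0.
Proof.
  rewrite <- RtoC_S. intros H; apply RtoC_inj in H. apply (not_0_INR (S n)); [lia | exact H].
Qed.

Lemma nonpos_int_add z n : ~ nonpos_int z -> z + INR n <> 0.
Proof.
  intros Hz H; apply Hz; exists n. rewrite RtoC_opp.
  replace z with (z + INR n - INR n) by ring. rewrite H; ring.
Qed.

Lemma nonpos_int_neq_0 z : ~ nonpos_int z -> z <> 0.
Proof. intros Hz H; apply (nonpos_int_add z 0 Hz); rewrite H; simpl; ring. Qed.

Lemma nonpos_int_shift z n : ~ nonpos_int z -> ~ nonpos_int (z + INR n).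
Proof.
  intros Hz [m Hm]; apply Hz; exists (m + n)%nat.
  rewrite plus_INR, RtoC_opp, RtoC_plus. rewrite RtoC_opp in Hm.
  replace z with (z + INR n - INR n) by ring. rewrite Hm; ring.
Qed.

Lemma nonpos_int_succ z : ~ nonpos_int z -> ~ nonpos_int (z + 1).
Proof. intros Hz; apply (nonpos_int_shift z 1 Hz). Qed.

Lemma poch_neq_0 z n : ~ nonpos_int z -> poch z n <> 0.
Proof.
  intros Hz; induction n as [|n IH]; simpl; [apply C1_nz |].
  apply Cmult_neq_0; [assumption | now apply nonpos_int_add].
Qed.

Lemma poch_S_l z n : poch z (S n) = z * poch (z + 1) n.
Proof.
  induction n as [|n IH]; [simpl; ring |].
  change (poch z (S (S n))) with (poch z (S n) * (z + INR (S n))).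
  rewrite IH, RtoC_S; simpl; ring.
Qed.

(** Exponentiating a branch of the logarithm chosen factor by factor: each factor
    [z + j] is in the right half-plane, where the principal logarithm is available. *)
Lemma gauss_approx_exp (x y : R) n : (0 < x)%R ->
  gauss_approx (x, y) (S n) = Cexp (log_gaussR y n x, log_gaussI y n x).
Proof.
  intros Hx. induction n as [|n IH].
  - unfold gauss_approx, log_gaussR, log_gaussI; simpl. rewrite ln_1.
    replace ((x, y) * 0) with (RtoC 0) by ring. rewrite Cexp_0.
    unfold initR, initI.
    replace ((- clogR y x - clogR y (x + 1))%R, (- clogI y x - clogI y (x + 1))%R)
      with (- (clogR y x, clogI y x) + - (clogR y (x + 1), clogI y (x + 1)))
      by (apply C_eq; simpl; ring).
    rewrite Cexp_plus, !Cexp_opp, !Cexp_clog by lra.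
    replace (1 * ((x, y) + 0) * ((x, y) + 1)) with ((x, y) * ((x + 1)%R, y))
      by (apply C_eq; simpl; ring).
    assert ((x, y) <> RtoC 0) by (intros H; injection H; lra).
    assert (((x + 1)%R, y) <> RtoC 0) by (intros H0; injection H0; lra).
    field; split; assumption.
  - unfold log_gaussR, log_gaussI in *; simpl fsum.
    set (L := (fsum (initR y) (stepR y) n x, fsum (initI y) (stepI y) n x)) in *.
    pose proof (pos_INR n) as Hn.
    set (p := (INR n + 2)%R).
    replace ((fsum (initR y) (stepR y) n x + stepR y n x)%R,
             (fsum (initI y) (stepI y) n x + stepI y n x)%R)
      with (L + ((RtoC (ln p) + (x, y) * (ln p - ln (INR n + 1))%R)
                 + - (clogR y (x + p), clogI y (x + p)))).
    2: { unfold L, stepR, stepI; fold p; apply C_eq; simpl; ring. }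
    rewrite !Cexp_plus, Cexp_opp, Cexp_clog by (unfold p; lra).
    rewrite <- IH, Cexp_RtoC, exp_ln by (unfold p; lra).
    unfold gauss_approx.
    assert (HS : INR (S (S n)) = p) by (rewrite !S_INR; unfold p; ring).
    change (poch (x, y) (S (S (S n)))) with (poch (x, y) (S (S n)) * ((x, y) + INR (S (S n)))).
    rewrite HS. replace ((x, y) + p) with ((x + p)%R, y) by (apply C_eq; simpl; ring).
    replace (INR (fact (S (S n)))) with (p * INR (fact (S n)))%R
      by (rewrite (fact_simpl (S n)), mult_INR, HS; reflexivity).
    rewrite RtoC_mult.
    rewrite (S_INR n).
    replace ((x, y) * ln p) with ((x, y) * ln (INR n + 1) + (x, y) * (ln p - ln (INR n + 1))%R)
      by (rewrite RtoC_minus; ring).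
    rewrite Cexp_plus.
    assert (((x + p)%R, y) <> RtoC 0) by (intros H0; injection H0; unfold p; lra).
    assert (poch (x, y) (S (S n)) <> 0).
    { apply poch_neq_0. intros [k Hk]. injection Hk. pose proof (pos_INR k). lra. }
    field. split; assumption.
Qed.

(** Every [z] that is not a non-positive integer reaches the right half-plane after
    finitely many unit steps, none of which meets a pole. *)
Lemma right_half_plane_ind (P : C -> Prop) :
  (forall x y : R, (0 < x)%R -> P (x, y)) ->
  (forall z, ~ nonpos_int z -> P (z + 1) -> P z) ->
  forall z, ~ nonpos_int z -> P z.
Proof.
  intros H0 HS z Hz.
  destruct (nfloor_ex (Rabs (Re z))) as [m [_ Hm]]; [apply Rabs_pos |].
  assert (Hr : forall k w, ~ nonpos_int w -> (0 < Re w + INR k)%R -> P w).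
  { induction k as [|k IH]; intros [x y] Hw Hk.
    - apply H0; simpl in Hk; lra.
    - apply HS; [assumption |]. apply IH.
      + now apply nonpos_int_succ.
      + rewrite S_INR in Hk; simpl in *; lra. }
  apply (Hr (S m) z Hz). rewrite S_INR.
  pose proof (Rle_abs (- Re z)) as Ha. rewrite Rabs_Ropp in Ha. lra.
Qed.

Definition gauss_converges (z : C) : Prop := is_Clim (gauss_approx z) (CGamma z) /\ CGamma z <> 0.

Lemma CGamma_exp (x y : R) : (0 < x)%R ->
  is_Clim (gauss_approx (x, y)) (Cexp (log_GammaR y x, log_GammaI y x)).
Proof.
  intros Hx. apply is_Clim_incr.
  apply is_Clim_ext with (fun n => Cexp (log_gaussR y n x, log_gaussI y n x)).
  { intros n; symmetry; now apply gauss_approx_exp. }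
  destruct (log_Gamma_spec y x Hx) as [[H1 _] [H2 _]].
  apply (is_Clim_Cexp (fun n => (log_gaussR y n x, log_gaussI y n x)) (log_GammaR y x, log_GammaI y x)); split; assumption.
Qed.

Lemma CGamma_eq_exp (x y : R) : (0 < x)%R -> CGamma (x, y) = Cexp (log_GammaR y x, log_GammaI y x).
Proof.
  intros Hx; apply is_Clim_Clim_seq; now apply CGamma_exp.
Qed.

Lemma gauss_converges_right (x y : R) : (0 < x)%R -> gauss_converges (x, y).
Proof.
  intros Hx; split.
  - rewrite CGamma_eq_exp by assumption; now apply CGamma_exp.
  - rewrite CGamma_eq_exp by assumption; apply Cexp_neq_0.
Qed.

Lemma is_lim_seq_inv_INR : is_lim_seq (fun n => / INR n)%R 0%R.
Proof.
  replace (Finite 0) with (Rbar_inv p_infty) by reflexivity.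
  apply is_lim_seq_inv; [apply is_lim_seq_INR | discriminate].
Qed.

Lemma is_Clim_inv_INR : is_Clim (fun n => / RtoC (INR n)) 0.
Proof.
  apply is_Clim_ext_loc with (fun n => RtoC (/ INR n)).
  - exists 1%nat; intros n Hn. rewrite RtoC_inv; [reflexivity |]. apply not_0_INR; lia.
  - split; simpl; [apply is_lim_seq_inv_INR | apply is_lim_seq_const].
Qed.

Lemma is_Clim_ratio_INR z : is_Clim (fun n => (z + INR n) / INR n) 1.
Proof.
  apply is_Clim_ext_loc with (fun n => z * / INR n + 1).
  - exists 1%nat; intros n Hn. field. intros H; apply RtoC_inj in H.
    revert H; apply not_0_INR; lia.
  - replace (RtoC 1) with (z * 0 + 1) at 1 by ring.
    apply is_Clim_plus; [apply is_Clim_scal, is_Clim_inv_INR | apply is_Clim_const].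
Qed.

Lemma gauss_approx_shift z n : (1 <= n)%nat -> ~ nonpos_int z ->
  gauss_approx z n = gauss_approx (z + 1) n * ((z + 1 + INR n) / INR n) / z.
Proof.
  intros Hn Hz. unfold gauss_approx.
  assert (HnR : INR n <> 0%R) by (apply not_0_INR; lia).
  assert (HnC : RtoC (INR n) <> 0) by (intros H; apply RtoC_inj in H; auto).
  replace ((z + 1) * ln (INR n)) with (z * ln (INR n) + RtoC (ln (INR n))) by ring.
  rewrite Cexp_plus, Cexp_RtoC, exp_ln by (apply lt_0_INR; lia).
  rewrite (poch_S_l z n). simpl (poch (z + 1) (S n)).
  pose proof (poch_neq_0 (z + 1) n (nonpos_int_succ z Hz)).
  pose proof (nonpos_int_neq_0 z Hz).
  pose proof (nonpos_int_add (z + 1) n (nonpos_int_succ z Hz)).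
  field. repeat split; assumption.
Qed.

(** The functional equation already holds for the approximants up to the factor
    [(z+1+n)/n], which tends to 1. *)
Lemma gauss_converges_down z : ~ nonpos_int z -> gauss_converges (z + 1) ->
  gauss_converges z /\ CGamma z = CGamma (z + 1) / z.
Proof.
  intros Hz [Hlim Hne].
  pose proof (nonpos_int_neq_0 z Hz) as Hz0.
  assert (H : is_Clim (gauss_approx z) (CGamma (z + 1) / z)).
  { apply is_Clim_ext_loc with
      (fun n => gauss_approx (z + 1) n * ((z + 1 + INR n) / INR n) * / z).
    - exists 1%nat; intros n Hn; symmetry; now apply gauss_approx_shift.
    - replace (CGamma (z + 1) / z) with (CGamma (z + 1) * 1 * / z) by (field; assumption).
      apply is_Clim_mult; [| apply is_Clim_const].
      apply is_Clim_mult; [assumption | apply is_Clim_ratio_INR]. }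
  assert (HE : CGamma z = CGamma (z + 1) / z) by now apply is_Clim_Clim_seq.
  split; [| exact HE]. split; rewrite HE; [assumption |].
  unfold Cdiv; apply Cmult_neq_0; [assumption |].
  intros Hi. apply C1_nz. rewrite <- (Cinv_r z Hz0), Hi. ring.
Qed.

Lemma gauss_converges_all z : ~ nonpos_int z -> gauss_converges z.
Proof.
  revert z; apply right_half_plane_ind.
  - exact gauss_converges_right.
  - intros z Hz Hok. now apply gauss_converges_down.
Qed.

Lemma CGamma_lim z : ~ nonpos_int z -> is_Clim (gauss_approx z) (CGamma z).
Proof. intros Hz; now apply gauss_converges_all. Qed.

Lemma CGamma_neq_0 z : ~ nonpos_int z -> CGamma z <> 0.
Proof. intros Hz; now apply gauss_converges_all. Qed.

Lemma CGamma_S z : ~ nonpos_int z -> CGamma (z + 1) = z * CGamma z.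
Proof.
  intros Hz.
  rewrite (proj2 (gauss_converges_down z Hz (gauss_converges_all _ (nonpos_int_succ z Hz)))).
  field. now apply nonpos_int_neq_0.
Qed.

(** * The digamma function at points differing by integers *)

(** Derivative along the horizontal line through [z].  This is all that [C_derive]
    looks at, so no full complex differentiability of the gamma function has to be
    established. *)
Definition is_xderive (f : C -> C) (z d : C) : Prop :=
  is_derive (fun t => Re (f (t, Im z))) (Re z) (Re d) /\
  is_derive (fun t => Im (f (t, Im z))) (Re z) (Im d).

Lemma is_derive_quotient (g : R -> R) (x l : R) :
  is_derive g x l -> is_lim (fun t => (g t - g x) / (t - x))%R x l.
Proof.
  intros H; apply is_derive_Reals in H. apply is_lim_spec; intros eps.
  destruct (H eps (cond_pos eps)) as [delta Hd]. exists delta; intros t Ht Hne.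
  replace t with (x + (t - x))%R at 1 by ring. apply Hd; [lra | exact Ht].
Qed.

Lemma C_derive_xderive f z d : is_xderive f z d -> C_derive f z = d.
Proof.
  intros [H1 H2]; unfold C_derive, C_lim.
  apply is_derive_quotient in H1; apply is_derive_quotient in H2.
  assert (Hz : forall t, t <> fst z -> (f (t, snd z) - f z) / ((t, snd z) - z)
    = RtoC (/ (t - fst z)) * (f (t, snd z) - f z)).
  { intros t Ht. replace ((t, snd z) - z) with (RtoC (t - fst z))
      by (apply C_eq; simpl; unfold Re, Im; ring).
    rewrite RtoC_inv by lra. unfold Cdiv; ring. }
  assert (E : forall (pr : C -> R) l,
    (forall r w, pr (RtoC r * w) = (r * pr w)%R) ->
    (forall u v, pr (u - v) = (pr u - pr v)%R) ->
    is_lim (fun t => (pr (f (t, Im z)) - pr (f (Re z, Im z))) / (t - Re z))%R (Re z) l ->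
    is_lim (fun t => pr ((f (t, snd z) - f z) / ((t, snd z) - z))) (fst z) l).
  { intros pr l Hm Hs Hl. eapply is_lim_ext_loc; [| exact Hl].
    exists (mkposreal 1 Rlt_0_1); intros t _ Ht.
    rewrite (Hz t Ht), Hm, Hs. replace (f (Re z, Im z)) with (f z) by (now destruct z).
    unfold Re, Im, Rdiv; ring. }
  rewrite (is_lim_unique _ _ (Finite (Re d))), (is_lim_unique _ _ (Finite (Im d))).
  - now apply C_eq.
  - apply (E Im); [intros; apply im_scal_l | reflexivity | exact H2].
  - apply (E Re); [intros; apply re_scal_l | reflexivity | exact H1].
Qed.

Lemma locally_add (x a : R) (P : R -> Prop) :
  locally (x + a)%R P -> locally x (fun t => P (t + a)%R).
Proof.
  intros [eps H]; exists eps; intros t Ht; apply H.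
  unfold ball in *; simpl in *; unfold AbsRing_ball in *; simpl in *.
  unfold minus, plus, opp, abs in *; simpl in *.
  replace (t + a + - (x + a))%R with (t + - x)%R by ring. exact Ht.
Qed.

Lemma locally_not_nonpos_int z :
  ~ nonpos_int z -> locally (Re z) (fun t => ~ nonpos_int (t, Im z)).
Proof.
  revert z; apply right_half_plane_ind.
  - intros x y Hx. apply filter_imp with (2 := open_gt 0 x Hx).
    intros t Ht [k Hk]; injection Hk; pose proof (pos_INR k); lra.
  - intros z Hz H.
    assert (Hne : locally (Re z) (fun t => (t, Im z) <> RtoC 0)).
    { destruct (Req_dec (Im z) 0) as [Hi | Hi].
      - apply filter_imp with (fun t => t <> 0%R); [intros t Ht E; injection E; auto |].
        apply (open_neq 0). intros E; apply (nonpos_int_neq_0 z Hz). now apply C_eq.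
      - apply filter_forall. intros t E; injection E; auto. }
    apply locally_add in H. generalize (filter_and _ _ Hne H).
    apply filter_imp; intros t [H1 H2] [k Hk]. destruct k as [|k].
    + apply H1. rewrite Hk. simpl; now rewrite Ropp_0.
    + apply H2; exists k. rewrite S_INR in Hk. injection Hk; intros E1 E2.
      unfold Im in *; apply C_eq; simpl in *; lra.
Qed.

Lemma is_xderive_mult f g z df dg :
  is_xderive f z df -> is_xderive g z dg ->
  is_xderive (fun w => f w * g w) z (df * g z + f z * dg).
Proof.
  intros [Hf1 Hf2] [Hg1 Hg2].
  replace (g z) with (g (Re z, Im z)) by (now destruct z).
  replace (f z) with (f (Re z, Im z)) by (now destruct z).
  split; apply is_derive_Reals; apply is_derive_Reals in Hf1, Hf2, Hg1, Hg2; simpl.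
  - pose proof (derivable_pt_lim_minus _ _ _ _ _
      (derivable_pt_lim_mult _ _ _ _ _ Hf1 Hg1) (derivable_pt_lim_mult _ _ _ _ _ Hf2 Hg2)) as H.
    replace (_ + _)%R with
      (Re df * Re (g (Re z, Im z)) + Re (f (Re z, Im z)) * Re dg
       - (Im df * Im (g (Re z, Im z)) + Im (f (Re z, Im z)) * Im dg))%R
      by (unfold Re, Im; simpl; ring).
    exact H.
  - pose proof (derivable_pt_lim_plus _ _ _ _ _
      (derivable_pt_lim_mult _ _ _ _ _ Hf1 Hg2) (derivable_pt_lim_mult _ _ _ _ _ Hf2 Hg1)) as H.
    replace (_ + _)%R with
      (Re df * Im (g (Re z, Im z)) + Re (f (Re z, Im z)) * Im dg
       + (Im df * Re (g (Re z, Im z)) + Im (f (Re z, Im z)) * Re dg))%R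
      by (unfold Re, Im; simpl; ring).
    exact H.
Qed.

Lemma is_xderive_id z : is_xderive (fun w => w) z 1.
Proof. split; simpl; auto_derive; trivial. Qed.

Lemma is_xderive_inv (z : C) : z <> 0 -> is_xderive (fun w => / w) z (- / (z * z)).
Proof.
  intros Hz; apply C_neq_0_norm2 in Hz.
  destruct z as [x y]; simpl in Hz.
  assert (Hz' : (x * x + y * y <> 0)%R) by (intros H; apply Hz; rewrite <- H; ring).
  assert ((x * x - y * y) ^ 2 + (x * y + y * x) ^ 2 <> 0)%R.
  { replace (_ + _)%R with ((x * x + y * y) ^ 2)%R by ring. now apply pow_nonzero. }
  split; simpl; auto_derive; try assumption; field; repeat split; try assumption;
    intros H0; apply H; rewrite <- H0; ring.
Qed.

Lemma is_xderive_ext f g z d :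
  locally (Re z) (fun t => f (t, Im z) = g (t, Im z)) ->
  is_xderive f z d -> is_xderive g z d.
Proof.
  intros He [H1 H2]; split;
    [apply is_derive_ext_loc with (2 := H1) | apply is_derive_ext_loc with (2 := H2)];
    apply filter_imp with (2 := He); intros t Ht; now apply f_equal.
Qed.

Lemma is_xderive_shift f z (r : R) d :
  is_xderive f (z + r) d -> is_xderive (fun w => f (w + r)) z d.
Proof.
  intros [H1 H2]; simpl in H1, H2; split; simpl;
    [apply (is_derive_shift (fun t => Re (f (t, (Im z + 0)%R))))
    | apply (is_derive_shift (fun t => Im (f (t, (Im z + 0)%R))))]; assumption.
Qed.

Lemma CGamma_ex_xderive z : ~ nonpos_int z -> exists d, is_xderive CGamma z d.
Proof.
  revert z; apply right_half_plane_ind.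
  - intros x y Hx. destruct (log_Gamma_spec y x Hx) as [[_ [dR HR]] [_ [dI HI]]].
    exists (Cexp (log_GammaR y x, log_GammaI y x) * (dR, dI)).
    assert (ER : Derive (fun x => log_GammaR y x) x = dR) by now apply is_derive_unique.
    assert (EI : Derive (fun x => log_GammaI y x) x = dI) by now apply is_derive_unique.
    apply is_xderive_ext with (fun w => Cexp (log_GammaR y (Re w), log_GammaI y (Re w))).
    + simpl. apply filter_imp with (2 := open_gt 0 x Hx). intros t Ht.
      now rewrite CGamma_eq_exp.
    + split; simpl; auto_derive; try (repeat split; eexists; eassumption);
        rewrite ER, EI; ring.
  - intros z Hz [d Hd].
    apply (is_xderive_shift _ z 1) in Hd.
    pose proof (is_xderive_mult _ _ _ _ _ Hd (is_xderive_inv z (nonpos_int_neq_0 z Hz))) as H.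
    eexists; eapply is_xderive_ext; [| exact H].
    apply filter_imp with (2 := locally_not_nonpos_int z Hz). intros t Ht.
    rewrite (CGamma_S (t, Im z) Ht). field. now apply nonpos_int_neq_0.
Qed.

(** Logarithmic derivative of the functional equation of the gamma function. *)
Lemma digamma_S z : ~ nonpos_int z -> digamma (z + 1) = digamma z + / z.
Proof.
  intros Hz. destruct (CGamma_ex_xderive z Hz) as [d Hd].
  assert (H1 : is_xderive CGamma (z + 1) (1 * CGamma z + z * d)).
  { assert (H : is_xderive (fun w => w * CGamma w) z (1 * CGamma z + z * d))
      by (apply is_xderive_mult; [apply is_xderive_id | exact Hd]).
    apply is_xderive_ext with (fun w => (w + RtoC (-1)) * CGamma (w + RtoC (-1))).
    - assert (HL := locally_not_nonpos_int z Hz).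
      replace (Re z) with (Re (z + 1) + -1)%R in HL by (unfold Re; simpl; ring).
      apply locally_add in HL. apply filter_imp with (2 := HL). intros t Ht.
      replace ((t, Im (z + 1)) + RtoC (-1)) with ((t + -1)%R, Im z) by (unfold Im; apply C_eq; simpl; ring).
      rewrite <- CGamma_S by assumption. f_equal; unfold Im; apply C_eq; simpl; ring.
    - apply (is_xderive_shift (fun w => w * CGamma w)).
      replace (z + 1 + RtoC (-1)) with z by (apply C_eq; unfold Re, Im; simpl; ring). exact H. }
  unfold digamma.
  rewrite (C_derive_xderive _ _ _ H1), (C_derive_xderive _ _ _ Hd), CGamma_S by assumption.
  field. split; [now apply nonpos_int_neq_0 | now apply CGamma_neq_0].
Qed.

Definition harmonic (b : C) (k : nat) : C := csum (fun j => / (b + INR j)) k.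

Lemma digamma_add z k : ~ nonpos_int z -> digamma (z + INR k) - digamma z = harmonic z k.
Proof.
  intros Hz; unfold harmonic; induction k as [|k IH].
  - simpl. rewrite Cplus_0_r. ring.
  - simpl csum. rewrite <- IH, RtoC_S.
    replace (z + (INR k + 1)) with (z + INR k + 1) by ring.
    rewrite digamma_S by now apply nonpos_int_shift. ring.
Qed.

(** * Gauss's summation theorem under the weak decay condition *)

Definition hyp2F1_term (a c e : C) (k : nat) : C :=
  poch a k * poch c k / (poch e k * INR (fact k)).

(** [u k = o(1/k)].  For hypergeometric terms it stands for [Re (e - a - c) > 0]
    without excluding terminating series. *)
Definition o_inv (u : nat -> C) : Prop := is_Clim (fun k => INR k * u k) 0.

Lemma hyp2F1_term_S a c e k : ~ nonpos_int e ->
  hyp2F1_term a c e (S k)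
  = hyp2F1_term a c e k * ((a + INR k) * (c + INR k) / ((e + INR k) * (INR k + 1))).
Proof.
  intros He; unfold hyp2F1_term. rewrite fact_simpl, mult_INR, RtoC_mult, RtoC_S. simpl poch.
  pose proof (poch_neq_0 e k He). pose proof (nonpos_int_add e k He).
  pose proof (INR_fact_neq_0_C k). pose proof (RtoC_S_neq_0 k).
  field. repeat split; assumption.
Qed.

Lemma hyp2F1_term_succ_lower a c e k : ~ nonpos_int e ->
  hyp2F1_term a c (e + 1) k = hyp2F1_term a c e k * (e / (e + INR k)).
Proof.
  intros He; unfold hyp2F1_term.
  pose proof (poch_S_l e k) as HS; simpl in HS.
  pose proof (poch_neq_0 e k He). pose proof (nonpos_int_add e k He).
  pose proof (nonpos_int_neq_0 e He).
  pose proof (INR_fact_neq_0_C k).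
  replace (poch (e + 1) k) with (poch e k * (e + INR k) / e)
    by (rewrite HS; field; assumption).
  field. repeat split; assumption.
Qed.

(** Termwise, [e (e-a-c) f_k(e) - (e-a)(e-c) f_k(e+1)] is the increment of
    [- e k f_k(e)]; the boundary term is negligible exactly when
    [f_k = o(1/k)]. *)
Lemma gauss_contiguous a c e N : ~ nonpos_int e ->
  e * (e - a - c) * csum (hyp2F1_term a c e) N
  = (e - a) * (e - c) * csum (hyp2F1_term a c (e + 1)) N - e * (INR N * hyp2F1_term a c e N).
Proof.
  intros He; induction N as [|N IH]; [simpl; ring |].
  simpl csum. rewrite !Cmult_plus_distr_l, IH, hyp2F1_term_S, hyp2F1_term_succ_lower, RtoC_S by assumption.
  pose proof (nonpos_int_add e N He). pose proof (RtoC_S_neq_0 N).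
  field. split; assumption.
Qed.

Lemma eventually_add_INR_neq_0 z : eventually (fun n => z + INR n <> 0).
Proof.
  destruct (nfloor_ex (Rabs (Re z))) as [m [_ Hm]]; [apply Rabs_pos |].
  exists (S m); intros n Hn E. apply (f_equal Re) in E; simpl in E.
  assert (INR m + 1 <= INR n)%R by (rewrite <- S_INR; now apply le_INR).
  pose proof (Rle_abs (- Re z)) as Ha. rewrite Rabs_Ropp in Ha. unfold Re in *; lra.
Qed.

(** Rational functions of [n] enter the proof only through quotients of two such
    affine factors. *)
Lemma is_Clim_ratio w z : is_Clim (fun n => (w + INR n) / (z + INR n)) 1.
Proof.
  pose proof (eventually_add_INR_neq_0 z) as Hz.
  apply is_Clim_ext_loc with (fun n => ((w + INR n) / INR n) / ((z + INR n) / INR n)).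
  - destruct Hz as [m Hm]. exists (S m); intros n Hn.
    assert (RtoC (INR n) <> 0).
    { intros E; apply RtoC_inj in E; revert E; apply not_0_INR; lia. }
    field. split; [| assumption]. apply Hm; lia.
  - replace (RtoC 1) with (1 / 1) by (field; apply C1_nz).
    apply is_Clim_div; [apply C1_nz | |]; apply is_Clim_ratio_INR.
Qed.

(** Raising the lower parameter gains one order of decay, which makes the series
    absolutely convergent. *)
Lemma hyp2F1_term_succ_lower_o a c e : ~ nonpos_int e -> o_inv (hyp2F1_term a c e) ->
  is_Clim (fun k => (INR k + 1) * (INR k + 2) * hyp2F1_term a c (e + 1) k) 0.
Proof.
  intros He H.
  apply is_Clim_ext_loc with (fun k => e * (INR k * hyp2F1_term a c e k)
    * (((1 + INR k) / INR k) * ((2 + INR k) / (e + INR k)))).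
  - exists 1%nat; intros k Hk. rewrite hyp2F1_term_succ_lower by assumption.
    assert (RtoC (INR k) <> 0).
    { intros E; apply RtoC_inj in E; revert E; apply not_0_INR; lia. }
    field. split; [now apply nonpos_int_add | assumption].
  - replace (RtoC 0) with (e * 0 * (1 * 1)) by ring.
    apply is_Clim_mult; [now apply is_Clim_scal |].
    apply is_Clim_mult; [apply is_Clim_ratio_INR | apply is_Clim_ratio].
Qed.

Lemma o_inv_succ a c e : ~ nonpos_int e -> o_inv (hyp2F1_term a c e) ->
  o_inv (hyp2F1_term a c (e + 1)).
Proof.
  intros He H. apply hyp2F1_term_succ_lower_o in H; [| assumption].
  apply is_Clim_0_Cmod in H. unfold o_inv. apply is_Clim_0_le with (2 := H).
  exists 0%nat; intros k _. rewrite !Cmod_mult.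
  apply Rmult_le_compat_r; [apply Cmod_ge_0 |].
  rewrite <- !RtoC_plus, !Cmod_R. pose proof (pos_INR k).
  rewrite !Rabs_pos_eq by lra. nra.
Qed.

Lemma o_inv_shift a c e m : ~ nonpos_int e -> o_inv (hyp2F1_term a c e) ->
  o_inv (hyp2F1_term a c (e + INR m)).
Proof.
  intros He H; induction m as [|m IH].
  - simpl. now rewrite Cplus_0_r.
  - rewrite RtoC_S, Cplus_assoc. apply o_inv_succ; [now apply nonpos_int_shift | assumption].
Qed.

Lemma hyp2F1_term_pronic_bound a c e : ~ nonpos_int e -> o_inv (hyp2F1_term a c e) ->
  exists A, forall k, (Cmod (hyp2F1_term a c (e + 1) k) <= A * inv_pronic k)%R.
Proof.
  intros He H. apply hyp2F1_term_succ_lower_o in H; [| assumption].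
  apply is_Clim_0_Cmod in H. apply is_lim_seq_Reals in H.
  destruct (maj_by_pos _ (exist _ _ H)) as [A [_ HA]].
  exists A; intros k. specialize (HA k). rewrite Rabs_pos_eq in HA by apply Cmod_ge_0.
  rewrite !Cmod_mult, <- !RtoC_plus, !Cmod_R in HA. pose proof (pos_INR k).
  rewrite !Rabs_pos_eq in HA by lra. unfold inv_pronic.
  apply Rmult_le_reg_l with ((INR k + 1) * (INR k + 2))%R; [nra |].
  eapply Rle_trans; [exact HA |]. right; field; lra.
Qed.

Lemma csum_pronic_bound u A n : (forall k, (Cmod (u k) <= A * inv_pronic k)%R) ->
  (Cmod (csum u n) <= A * (1 - / (INR n + 1)))%R.
Proof.
  intros H; induction n as [|n IH].
  - simpl. rewrite Cmod_0, Rplus_0_l, Rinv_1. lra.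
  - simpl csum. eapply Rle_trans; [apply Cmod_triangle |].
    specialize (H n). rewrite inv_pronic_telescope in H. lra.
Qed.

Lemma ex_series_inv_pronic : ex_series inv_pronic.
Proof.
  exists 1%R. change (is_lim_seq (sum_n inv_pronic) 1%R).
  apply (is_lim_seq_ext (fun n => 1 - / INR (S (S n)))%R).
  - intros n; induction n as [|n IH].
    + rewrite sum_O. unfold inv_pronic; simpl. field.
    + rewrite sum_Sn, <- IH, inv_pronic_telescope. unfold plus; simpl plus.
      rewrite !(S_INR (S _)), !S_INR. simpl. ring.
  - replace (Finite 1) with (Finite (1 - 0)) by (f_equal; ring).
    apply is_lim_seq_minus'; [apply is_lim_seq_const |].
    apply (is_lim_seq_incr_1 (fun n => / INR (S n))%R).
    apply (is_lim_seq_incr_1 (fun n => / INR n)%R). apply is_lim_seq_inv_INR.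
Qed.

Lemma csum_pronic_cv u A : (forall k, (Cmod (u k) <= A * inv_pronic k)%R) ->
  is_Clim (csum u) (Cseries u).
Proof.
  intros H.
  assert (HA : ex_series (fun k => A * inv_pronic k)%R) by exact (ex_series_scal A inv_pronic ex_series_inv_pronic).
  apply is_Clim_csum; split; apply Series_correct.
  - apply (@ex_series_le R_AbsRing R_CompleteNormedModule) with (2 := HA).
    intros k; eapply Rle_trans; [| apply H]. eapply Rle_trans; [apply Rmax_l | apply Rmax_Cmod].
  - apply (@ex_series_le R_AbsRing R_CompleteNormedModule) with (2 := HA).
    intros k; eapply Rle_trans; [| apply H]. eapply Rle_trans; [apply Rmax_r | apply Rmax_Cmod].
Qed.

Lemma Cmod_shift_mono z (r s : R) : (0 < Re z)%R -> (0 <= r <= s)%R ->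
  (Cmod (z + r) <= Cmod (z + s))%R.
Proof.
  intros Hz [Hr Hs]. unfold Cmod. apply sqrt_le_1_alt. unfold Re in Hz. simpl. nra.
Qed.

(** For [Re z > 0] every factor of the shifted Pochhammer symbol dominates the
    unshifted one; the first factor alone gives the decay in [m]. *)
Lemma poch_shift_bound z m k : (0 < Re z)%R ->
  (Cmod (poch z (S k)) * Cmod (z + INR m) <= Cmod z * Cmod (poch (z + INR m) (S k)))%R.
Proof.
  intros Hz; induction k as [|k IH].
  - simpl. rewrite !Cmult_1_l, !Cplus_0_r. lra.
  - change (poch ?w (S (S k))) with (poch w (S k) * (w + INR (S k))).
    rewrite !Cmod_mult.
    replace (z + INR m + INR (S k)) with (z + (INR m + INR (S k))%R)
      by (rewrite RtoC_plus; ring).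
    pose proof (Cmod_shift_mono z (INR (S k)) (INR m + INR (S k)) Hz) as Hm.
    pose proof (pos_INR m). pose proof (pos_INR (S k)).
    specialize (Hm ltac:(lra)).
    pose proof (Cmod_ge_0 (z + INR (S k))). pose proof (Cmod_ge_0 z).
    pose proof (Cmod_ge_0 (poch (z + INR m) (S k))).
    apply Rle_trans with
      ((Cmod z * Cmod (poch (z + INR m) (S k))) * Cmod (z + INR (S k)))%R.
    + replace (_ * _ * _)%R with
        (Cmod (poch z (S k)) * Cmod (z + INR m) * Cmod (z + INR (S k)))%R by ring.
      now apply Rmult_le_compat_r.
    + rewrite Rmult_assoc. apply Rmult_le_compat_l; [assumption |].
      now apply Rmult_le_compat_l.
Qed.

Lemma right_not_nonpos_int z : (0 < Re z)%R -> ~ nonpos_int z.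
Proof.
  intros Hz [k Hk]. rewrite Hk in Hz; simpl in Hz. pose proof (pos_INR k); lra.
Qed.

Lemma hyp2F1_term_shift_bound a c z m k : (0 < Re z)%R ->
  (Cmod (hyp2F1_term a c (z + INR m) (S k)) <= Cmod z / Cmod (z + INR m) * Cmod (hyp2F1_term a c z (S k)))%R.
Proof.
  intros Hz.
  assert (Hn := right_not_nonpos_int z Hz).
  assert (Hnm := nonpos_int_shift z m Hn).
  pose proof (poch_neq_0 _ (S k) Hn) as H1. pose proof (poch_neq_0 _ (S k) Hnm) as H2.
  pose proof (nonpos_int_neq_0 _ Hnm) as H3.
  pose proof (INR_fact_neq_0_C (S k)) as Hf.
  unfold hyp2F1_term. rewrite !Cmod_div, !Cmod_mult by now apply Cmult_neq_0.
  pose proof (poch_shift_bound z m k Hz) as Hb.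
  apply Cmod_gt_0 in H1. apply Cmod_gt_0 in H2. apply Cmod_gt_0 in H3. apply Cmod_gt_0 in Hf.
  set (P := Cmod (poch z (S k))) in *. set (Q := Cmod (poch (z + INR m) (S k))) in *.
  set (n := (Cmod (poch a (S k)) * Cmod (poch c (S k)))%R).
  assert (Hn0 : (0 <= n)%R) by (apply Rmult_le_pos; apply Cmod_ge_0).
  set (F := Cmod (INR (fact (S k)))) in *.
  apply Rmult_le_reg_r with (Q * F * P * Cmod (z + INR m))%R.
  { repeat apply Rmult_lt_0_compat; assumption. }
  replace (n / (Q * F) * (Q * F * P * Cmod (z + INR m)))%R
    with (n * (P * Cmod (z + INR m)))%R by (field; lra).
  replace (_ / _ * _ * _)%R with (n * (Cmod z * Q))%R by (field; lra).
  now apply Rmult_le_compat_l.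
Qed.

(** As the lower parameter goes to infinity only the term of index 0 survives: the
    remaining ones are dominated by those of a fixed summable series times
    [Cmod z / Cmod (z + m)]. *)
Lemma hyp2F1_far a c z A :
  (0 < Re z)%R -> (forall k, (Cmod (hyp2F1_term a c z k) <= A * inv_pronic k)%R) ->
  is_Clim (fun m => Cseries (hyp2F1_term a c (z + INR m))) 1.
Proof.
  intros Hz HA.
  assert (HA0 : (0 <= A)%R).
  { specialize (HA 0%nat). pose proof (Cmod_ge_0 (hyp2F1_term a c z 0)). pose proof (inv_pronic_pos 0). nra. }
  assert (Hm : forall m, (0 < Cmod (z + INR m))%R).
  { intros m; apply Cmod_gt_0. apply nonpos_int_add; now apply right_not_nonpos_int. }
  assert (Hle : forall m k, (Cmod (hyp2F1_term a c (z + INR m) (S k))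
     <= Cmod z / Cmod (z + INR m) * A * inv_pronic k)%R).
  { intros m k. eapply Rle_trans; [now apply hyp2F1_term_shift_bound |].
    rewrite Rmult_assoc. apply Rmult_le_compat_l.
    - apply Rmult_le_pos; [apply Cmod_ge_0 | left; now apply Rinv_0_lt_compat].
    - eapply Rle_trans; [apply HA |]. apply Rmult_le_compat_l; [assumption |].
      unfold inv_pronic; rewrite S_INR. pose proof (pos_INR k). apply Rinv_le_contravar; nra. }
  replace (RtoC 1) with (1 + 0) by ring.
  apply is_Clim_ext with
    (fun m => 1 + Cseries (fun k => hyp2F1_term a c (z + INR m) (S k))).
  { intros m. symmetry; apply is_Clim_Cseries, is_Clim_incr.
    apply is_Clim_ext with (fun n => 1 + csum (fun k => hyp2F1_term a c (z + INR m) (S k)) n).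
    - intros n; rewrite csum_shift. f_equal. unfold hyp2F1_term; simpl. field.
    - apply is_Clim_plus; [apply is_Clim_const |]. eapply csum_pronic_cv; apply Hle. }
  apply is_Clim_plus; [apply is_Clim_const |].
  apply is_Clim_0_le with (fun m => (Cmod z * A * / INR m)%R).
  - exists 1%nat; intros m Hm1.
    pose proof (csum_pronic_cv _ _ (Hle m)) as Hcv.
    set (u := fun k => hyp2F1_term a c (z + INR m) (S k)) in *.
    assert (Hd : is_Clim (fun n => Cseries u - csum u n) 0).
    { apply is_Clim_ext with (fun n => Cseries u + (-1) * csum u n); [intros; ring |].
      replace (RtoC 0) with (Cseries u + (-1) * Cseries u) by ring.
      apply is_Clim_plus; [apply is_Clim_const | now apply is_Clim_scal]. }
    apply is_Clim_0_Cmod in Hd.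
    assert (HmR : (0 < INR m)%R) by (apply lt_0_INR; lia).
    assert (HmC : (INR m <= Cmod (z + INR m))%R).
    { eapply Rle_trans; [| apply re_le_Cmod]. unfold Re in *; simpl. rewrite Rabs_pos_eq; lra. }
    change (Rbar_le (Cmod (Cseries u)) (Cmod z * A * / INR m)%R).
    apply is_lim_seq_le with (fun _ => Cmod (Cseries u))
      (fun n => (Cmod z * A * / INR m + Cmod (Cseries u - csum u n))%R).
    + intros n. eapply Rle_trans; [apply (Cmod_le_add _ (csum u n)) |].
      apply Rplus_le_compat_r. eapply Rle_trans; [apply csum_pronic_bound, (Hle m) |].
      pose proof (Cmod_ge_0 z). pose proof (pos_INR n).
      assert (0 < / (INR n + 1))%R by (apply Rinv_0_lt_compat; lra).
      assert (Hi : (/ Cmod (z + INR m) <= / INR m)%R) by now apply Rinv_le_contravar.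
      assert (0 < / Cmod (z + INR m))%R by now apply Rinv_0_lt_compat.
      assert (0 <= Cmod z / Cmod (z + INR m) * A)%R.
      { apply Rmult_le_pos; [apply Rmult_le_pos |]; lra. }
      apply Rle_trans with (Cmod z / Cmod (z + INR m) * A)%R; [nra |].
      unfold Rdiv. replace (Cmod z * A * / INR m)%R with (Cmod z * / INR m * A)%R by ring.
      apply Rmult_le_compat_r; [assumption |]. now apply Rmult_le_compat_l.
    + apply is_lim_seq_const.
    + replace (Finite (Cmod z * A * / INR m)) with (Finite (Cmod z * A * / INR m + 0))
        by (f_equal; ring).
      apply is_lim_seq_plus'; [apply is_lim_seq_const | exact Hd].
  - replace 0%R with (Cmod z * A * 0)%R by ring.
    apply is_lim_seq_mult'; [apply is_lim_seq_const | apply is_lim_seq_inv_INR].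
Qed.

Definition gauss_value (a c e : C) : C :=
  CGamma e * CGamma (e - a - c) / (CGamma (e - a) * CGamma (e - c)).

(** Iterating the contiguous relation [m] times expresses the sum at [e] as a
    quotient of Pochhammer symbols times the sum at [e + m].  The latter tends to
    1, and the former is the quotient of Gauss approximants, since the powers of
    [n] cancel by [e + (e-a-c) = (e-a) + (e-c)]. *)
Section GaussTheorem.

Variables a c e : C.
Hypothesis He : ~ nonpos_int e.
Hypothesis Heac : ~ nonpos_int (e - a - c).
Hypothesis Hea : ~ nonpos_int (e - a).
Hypothesis Hec : ~ nonpos_int (e - c).
Hypothesis Hsmall : o_inv (hyp2F1_term a c e).

Let F (m : nat) : C := Cseries (hyp2F1_term a c (e + INR m)).

Lemma gauss_cv_succ m : is_Clim (csum (hyp2F1_term a c (e + INR (S m)))) (F (S m)).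
Proof.
  destruct (hyp2F1_term_pronic_bound a c (e + INR m)) as [A HA].
  - now apply nonpos_int_shift.
  - now apply o_inv_shift.
  - apply csum_pronic_cv with A. intros k. rewrite RtoC_S, Cplus_assoc. apply HA.
Qed.

Lemma gauss_recurrence m :
  is_Clim (csum (hyp2F1_term a c (e + INR m)))
    ((e - a + INR m) * (e - c + INR m) / ((e + INR m) * (e - a - c + INR m)) * F (S m)).
Proof.
  pose proof (nonpos_int_add _ m He) as H1. pose proof (nonpos_int_add _ m Heac) as H2.
  set (em := e + INR m) in *.
  apply is_Clim_ext with (fun N =>
    / (em * (e - a - c + INR m)) * ((e - a + INR m) * (e - c + INR m) * csum (hyp2F1_term a c (em + 1)) N
      + (- em) * (INR N * hyp2F1_term a c em N))).
  - intros N. pose proof (gauss_contiguous a c em N (nonpos_int_shift _ m He)) as HG.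
    replace (em - a - c) with (e - a - c + INR m) in HG by (unfold em; ring).
    replace (em - a) with (e - a + INR m) in HG by (unfold em; ring).
    replace (em - c) with (e - c + INR m) in HG by (unfold em; ring).
    replace ((e - a + INR m) * (e - c + INR m) * csum (hyp2F1_term a c (em + 1)) N
      + (- em) * (INR N * hyp2F1_term a c em N))
      with (em * (e - a - c + INR m) * csum (hyp2F1_term a c em) N) by (rewrite HG; ring).
    field. split; assumption.
  - replace (_ * F (S m)) with
      (/ (em * (e - a - c + INR m)) * ((e - a + INR m) * (e - c + INR m) * F (S m) + (- em) * 0))
      by (field; split; assumption).
    apply is_Clim_scal, is_Clim_plus.
    + apply is_Clim_scal. pose proof (gauss_cv_succ m) as H. rewrite RtoC_S, Cplus_assoc in H.
      exact H.
    + apply is_Clim_scal. now apply o_inv_shift.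
Qed.

Lemma gauss_iterate m :
  F 0 = poch (e - a) m * poch (e - c) m / (poch e m * poch (e - a - c) m) * F m.
Proof.
  induction m as [|m IH].
  - simpl. field.
  - rewrite IH. unfold F at 1. rewrite (is_Clim_Cseries _ _ (gauss_recurrence m)).
    simpl poch.
    pose proof (poch_neq_0 _ m He). pose proof (poch_neq_0 _ m Heac).
    pose proof (nonpos_int_add _ m He). pose proof (nonpos_int_add _ m Heac).
    field. repeat split; assumption.
Qed.

Lemma gauss_far : is_Clim F 1.
Proof.
  destruct (nfloor_ex (Rabs (Re e))) as [m [_ Hm]]; [apply Rabs_pos |].
  destruct (hyp2F1_term_pronic_bound a c (e + INR m)) as [A HA];
    [now apply nonpos_int_shift | now apply o_inv_shift |].
  assert (H : is_Clim (fun n => F (n + S m)) 1).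
  { apply is_Clim_ext with (fun n => Cseries (hyp2F1_term a c (e + INR m + 1 + INR n))).
    - intros n; unfold F. do 2 f_equal. rewrite plus_INR, RtoC_plus, RtoC_S. ring.
    - apply hyp2F1_far with A; [| exact HA]. simpl.
      pose proof (Rle_abs (- Re e)) as Ha. rewrite Rabs_Ropp in Ha. unfold Re in *; simpl in *; lra. }
  destruct H as [H1 H2].
  apply (is_lim_seq_incr_n (fun n => Re (F n))) in H1.
  apply (is_lim_seq_incr_n (fun n => Im (F n))) in H2.
  now split.
Qed.

Theorem gauss_summation : is_Clim (csum (hyp2F1_term a c e)) (gauss_value a c e).
Proof.
  assert (HF : is_Clim (csum (hyp2F1_term a c e)) (F 0)).
  { pose proof (gauss_recurrence 0) as H. unfold F at 1.
    rewrite (is_Clim_Cseries _ _ H). simpl (INR 0) in H at 1. rewrite Cplus_0_r in H.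
    exact H. }
  replace (gauss_value a c e) with (F 0); [exact HF |].
  apply is_Clim_unique with (fun _ : nat => F 0); [apply is_Clim_const |].
  apply is_Clim_ext_loc with (fun n =>
    gauss_approx e n * gauss_approx (e - a - c) n / (gauss_approx (e - a) n * gauss_approx (e - c) n) * F (S n)).
  - exists 1%nat; intros n Hn. rewrite (gauss_iterate (S n)).
    unfold gauss_approx.
    set (L := RtoC (ln (INR n))).
    (* The powers of [n] cancel. *)
    assert (HE : Cexp (e * L) * Cexp ((e - a - c) * L) = Cexp ((e - a) * L) * Cexp ((e - c) * L)).
    { rewrite <- !Cexp_plus. f_equal; ring. }
    pose proof (Cexp_neq_0 ((e - a) * L)). pose proof (Cexp_neq_0 ((e - c) * L)).
    pose proof (INR_fact_neq_0_C n).
    pose proof (poch_neq_0 _ (S n) He). pose proof (poch_neq_0 _ (S n) Heac).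
    pose proof (poch_neq_0 _ (S n) Hea). pose proof (poch_neq_0 _ (S n) Hec).
    set (f := RtoC (INR (fact n))) in *.
    replace (f * Cexp (e * L) / poch e (S n) *
      (f * Cexp ((e - a - c) * L) / poch (e - a - c) (S n)))
      with (f * f * (Cexp (e * L) * Cexp ((e - a - c) * L)) / (poch e (S n) * poch (e - a - c) (S n)))
      by (field; split; assumption).
    rewrite HE. field. repeat split; assumption.
  - replace (gauss_value a c e) with (gauss_value a c e * 1) by ring.
    apply is_Clim_mult; [| apply is_Clim_incr; exact gauss_far].
    unfold gauss_value. apply is_Clim_div.
    + apply Cmult_neq_0; now apply CGamma_neq_0.
    + apply is_Clim_mult; now apply CGamma_lim.
    + apply is_Clim_mult; now apply CGamma_lim.
Qed.

End GaussTheorem.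

(** * Decay of the terms of a convergent series with digamma factors *)

Lemma harmonic_S_l z k : harmonic z (S k) = / z + harmonic (z + 1) k.
Proof.
  unfold harmonic. rewrite csum_shift. f_equal.
  - simpl; now rewrite Cplus_0_r.
  - apply csum_ext; intros j. rewrite RtoC_S. f_equal; ring.
Qed.

Lemma harmonic_S z k : harmonic z (S k) = harmonic z k + / (z + INR k).
Proof. reflexivity. Qed.

(** The real part is about [1 / j]; half of it bounds the logarithmic increment with
    room to spare, which makes the harmonic sums grow like a logarithm. *)
Lemma Re_inv_lower z j : (Rabs (Re z) + Rabs (Im z) + 1 <= INR j)%R ->
  ((ln (INR j + 2) - ln (INR j + 1)) / 2 <= Re (/ (z + INR j)))%R.
Proof.
  intros Hj. destruct z as [x y]; simpl in *.
  pose proof (Rle_abs x). pose proof (Rle_abs (- x)) as Hx; rewrite Rabs_Ropp in Hx.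
  pose proof (Rabs_pos y). pose proof (Rabs_pos x).
  pose proof (ln_step (INR j + 2) ltac:(lra)) as [_ Hl].
  replace (INR j + 2 - 1)%R with (INR j + 1)%R in Hl by ring.
  set (t := (x + INR j)%R).
  assert (Ht : (Rabs y + 1 <= t)%R) by (unfold t; lra).
  assert (Hy : (y * y <= t * Rabs y)%R).
  { replace (y * y)%R with (Rabs y * Rabs y)%R by (rewrite <- Rabs_mult; apply Rabs_pos_eq; nra).
    apply Rmult_le_compat_r; lra. }
  apply Rle_trans with (/ (INR j + 1) / 2)%R; [lra |].
  assert (HD : (0 < t * (t * 1) + (y + 0) * ((y + 0) * 1))%R) by nra.
  apply Rmult_le_reg_r with ((t * (t * 1) + (y + 0) * ((y + 0) * 1)) * (2 * (INR j + 1)))%R;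
    [apply Rmult_lt_0_compat; lra |].
  replace (/ (INR j + 1) / 2 * _)%R with (t * (t * 1) + (y + 0) * ((y + 0) * 1))%R by (field; lra).
  replace (t / _ * _)%R with (t * (2 * (INR j + 1)))%R by (field; lra).
  assert (t * Rabs y <= t * (INR j + 2 - x))%R by (apply Rmult_le_compat_l; lra).
  unfold t in *; nra.
Qed.

(** Being bounded away from 0 is what allows the increments of the digamma factor to
    be charged to the term itself, and the factor to be removed afterwards. *)
Lemma harmonic_ge_1 z : eventually (fun k => (1 <= Cmod (harmonic z k))%R).
Proof.
  destruct (nfloor_ex (Rabs (Re z) + Rabs (Im z) + 1)) as [m [_ Hm]].
  { pose proof (Rabs_pos (Re z)). pose proof (Rabs_pos (Im z)). lra. }
  set (J := S m).
  assert (HJ : (Rabs (Re z) + Rabs (Im z) + 1 <= INR J)%R) by (unfold J; rewrite S_INR; lra).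
  (* From [J] on, the real part dominates half a logarithm, up to the constant [C0]. *)
  set (C0 := (Re (harmonic z J) - ln (INR J + 1) / 2)%R).
  assert (H : forall k, (C0 + ln (INR (J + k) + 1) / 2 <= Re (harmonic z (J + k)))%R).
  { induction k as [|k IH]; [rewrite Nat.add_0_r; unfold C0; lra |].
    rewrite Nat.add_succ_r, harmonic_S, S_INR.
    pose proof (Re_inv_lower z (J + k)) as HR.
    assert (INR J <= INR (J + k))%R by (apply le_INR; lia).
    specialize (HR ltac:(lra)).
    replace (INR (J + k) + 1 + 1)%R with (INR (J + k) + 2)%R by ring.
    change (Re (harmonic z (J + k) + / (z + INR (J + k))))
      with (Re (harmonic z (J + k)) + Re (/ (z + INR (J + k))))%R. lra. }
  destruct (nfloor_ex (exp (2 * (1 - C0)))) as [M [_ HM]]; [left; apply exp_pos |].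
  exists (J + M)%nat; intros k Hk.
  specialize (H (k - J)%nat). replace (J + (k - J))%nat with k in H by lia.
  assert (2 * (1 - C0) <= ln (INR k + 1))%R.
  { rewrite <- (ln_exp (2 * (1 - C0))). apply ln_le; [apply exp_pos |].
    assert (INR M <= INR k)%R by (apply le_INR; lia). lra. }
  eapply Rle_trans; [| apply re_le_Cmod]. eapply Rle_trans; [| apply Rle_abs]. lra.
Qed.

(** The convergence hypothesis on a single series with digamma differences is
    enough to extract the decay of its terms: the quotient of consecutive
    hypergeometric terms is [1 + O(1/k)], and so is that of the harmonic factors,
    so the block argument applies. *)
Section TermDecay.

Variables a c e b l : C.
Hypothesis He : ~ nonpos_int e.
Hypothesis Hcv : is_Clim (csum (fun k => hyp2F1_term a c e k * harmonic b k)) l.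

Lemma hat_term_o_inv : o_inv (fun k => hyp2F1_term a c e k * harmonic b k).
Proof.
  (* [B1] is [k + 1] times the relative increment of the hypergeometric term, [B2]
     that of the harmonic factor when the latter has size 1; both are bounded. *)
  assert (B1 : is_Clim (fun k => (a - 1) + (c - e) * ((a + INR k) / (e + INR k)))
    ((a - 1) + (c - e) * 1)).
  { apply is_Clim_plus; [apply is_Clim_const | apply is_Clim_scal, is_Clim_ratio]. }
  assert (B2 : is_Clim (fun k => ((a + INR k) / (e + INR k)) * ((c + INR k) / (b + INR k))) (1 * 1)).
  { apply is_Clim_mult; apply is_Clim_ratio. }
  apply is_Clim_bounded in B1. destruct B1 as [A1 HA1].
  apply is_Clim_bounded in B2. destruct B2 as [A2 HA2].
  destruct (nfloor_ex (Rabs (A1 + A2))) as [m [_ Hm]]; [apply Rabs_pos |].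
  destruct (harmonic_ge_1 b) as [N0 HN0].
  apply (slow_variation_summable _ (S m) N0) with (3 := Hcv); [lia |].
  intros k Hk. specialize (HN0 k Hk).
  pose proof (nonpos_int_add e k He) as Hek. pose proof (RtoC_S_neq_0 k) as Hk1.
  rewrite hyp2F1_term_S, harmonic_S by assumption.
  set (t := hyp2F1_term a c e k) in *. set (h := harmonic b k) in *.
  assert (HE : INR (S k) * (t * ((a + INR k) * (c + INR k) / ((e + INR k) * (INR k + 1)))
      * (h + / (b + INR k)) - t * h)
    = t * (((a - 1) + (c - e) * ((a + INR k) / (e + INR k))) * h
      + ((a + INR k) / (e + INR k)) * ((c + INR k) / (b + INR k)))).
  { rewrite RtoC_S. unfold Cdiv at 4. set (q := / (b + INR k)). field; split; assumption. }
  rewrite <- (Rabs_pos_eq (INR (S k))) at 1 by apply pos_INR.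
  rewrite <- Cmod_R, <- Cmod_mult, HE, !Cmod_mult.
  rewrite (Rmult_comm (INR (S m))), Rmult_assoc.
  apply Rmult_le_compat_l; [apply Cmod_ge_0 |].
  eapply Rle_trans; [apply Cmod_triangle |]. rewrite Cmod_mult.
  pose proof (HA1 k) as H1. pose proof (HA2 k) as H2.
  pose proof (Cmod_ge_0 ((a - 1) + (c - e) * ((a + INR k) / (e + INR k)))).
  pose proof (Cmod_ge_0 (((a + INR k) / (e + INR k)) * ((c + INR k) / (b + INR k)))).
  apply Rle_trans with ((A1 + A2) * Cmod h)%R.
  - rewrite Rmult_plus_distr_r. apply Rplus_le_compat.
    + apply Rmult_le_compat_r; [apply Cmod_ge_0 | exact H1].
    + eapply Rle_trans; [exact H2 |]. nra.
  - rewrite Rmult_comm. apply Rmult_le_compat_l; [apply Cmod_ge_0 |].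
    rewrite S_INR. pose proof (Rle_abs (A1 + A2)). lra.
Qed.

Lemma hyp2F1_term_o_inv : o_inv (hyp2F1_term a c e).
Proof.
  pose proof hat_term_o_inv as H. apply is_Clim_0_Cmod in H.
  apply is_Clim_0_le with (2 := H).
  destruct (harmonic_ge_1 b) as [N0 HN0]; exists N0; intros k Hk. specialize (HN0 k Hk).
  rewrite Cmult_assoc, (Cmod_mult _ (harmonic b k)).
  rewrite <- (Rmult_1_r (Cmod (INR k * _))) at 1.
  apply Rmult_le_compat_l; [apply Cmod_ge_0 | assumption].
Qed.

End TermDecay.

(** * Summation by parts and passage to the limit *)

Lemma hat_term_eq a c e b k : ~ nonpos_int b ->
  hyp2F1hat_term a c e b k = hyp2F1_term a c e k * harmonic b k.
Proof. intros Hb. unfold hyp2F1hat_term. now rewrite digamma_add. Qed.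

Lemma hat_lim a c e b : ~ nonpos_int b -> ex_hyp2F1hat a c e b ->
  is_Clim (csum (fun j => hyp2F1_term a c e (S j) * harmonic b (S j))) (hyp2F1hat a c e b).
Proof.
  intros Hb H. apply ex_Cseries_is_Clim in H.
  apply is_Clim_ext with (2 := H). intros n. apply csum_ext. intros k.
  now apply hat_term_eq.
Qed.

(** The term of index 0 vanishes, so the sum may start there; this is the form in
    which both series line up after the index shift. *)
Lemma hat_lim_0 a c e b : ~ nonpos_int b -> ex_hyp2F1hat a c e b ->
  is_Clim (csum (fun k => hyp2F1_term a c e k * harmonic b k)) (hyp2F1hat a c e b).
Proof.
  intros Hb H. apply is_Clim_incr.
  apply is_Clim_ext with (2 := hat_lim a c e b Hb H).
  intros n. rewrite csum_shift. unfold harmonic at 2; simpl. ring.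
Qed.

Lemma hyp3F2_lim a c e b : ~ nonpos_int e -> ~ nonpos_int b -> ex_hyp3F2 a c b e (b + 1) ->
  is_Clim (csum (fun j => hyp2F1_term a c e j * (b / (b + INR j)))) (hyp3F2 a c b e (b + 1)).
Proof.
  intros He Hb H. apply ex_Cseries_is_Clim in H.
  apply is_Clim_ext with (2 := H). intros N. apply csum_ext. intros n. unfold hyp3F2_term, hyp2F1_term.
  pose proof (poch_neq_0 e n He). pose proof (INR_fact_neq_0_C n).
  pose proof (poch_neq_0 b n Hb). pose proof (nonpos_int_add b n Hb).
  pose proof (nonpos_int_neq_0 b Hb).
  pose proof (poch_S_l b n) as HS; simpl in HS.
  replace (poch (b + 1) n) with (poch b n * (b + INR n) / b) by (rewrite HS; field; assumption).
  field. repeat split; assumption.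
Qed.

(** Multiplying by [c] avoids dividing by [c], which may be 0. *)
Lemma hyp2F1_term_raise a c e k : ~ nonpos_int e ->
  c * hyp2F1_term a (c + 1) (e + 1) k = e * (c + INR k) / (e + INR k) * hyp2F1_term a c e k.
Proof.
  intros He.
  rewrite hyp2F1_term_succ_lower by assumption. unfold hyp2F1_term.
  pose proof (poch_neq_0 e k He). pose proof (INR_fact_neq_0_C k).
  pose proof (nonpos_int_add e k He).
  pose proof (poch_S_l c k) as HS; simpl in HS.
  replace (c * _) with (poch a k * (c * poch (c + 1) k) / (poch e k * INR (fact k)) * (e / (e + INR k)))
    by (field; repeat split; assumption).
  rewrite <- HS. field. repeat split; assumption.
Qed.

Lemma hyp2F1_term_lower_S a c e k : ~ nonpos_int e ->
  hyp2F1_term (a - 1) c e (S k)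
  = (a - 1) * (c + INR k) / ((e + INR k) * (INR k + 1)) * hyp2F1_term a c e k.
Proof.
  intros He; unfold hyp2F1_term. rewrite (poch_S_l (a - 1) k).
  replace (a - 1 + 1) with a by ring.
  rewrite fact_simpl, mult_INR, RtoC_mult, RtoC_S. simpl poch.
  pose proof (poch_neq_0 e k He). pose proof (nonpos_int_add e k He).
  pose proof (INR_fact_neq_0_C k). pose proof (RtoC_S_neq_0 k).
  field. repeat split; assumption.
Qed.

(** Summation by parts.  Write [f], [u], [v] for the terms with parameters
    [(a, c; e)], [(a-1, c; e)], [(a, c+1; e+1)], and [h], [h'] for the harmonic
    sums at [b] and [b + 1].  As [h'_k = h_(k+1) - 1/b], both series with
    digamma factors carry the same [h_(k+1)], and the combined coefficient
    [c (u_(k+1) + (a+c-e)/e v_k)] is the increment of [(c+k) f_k].  Moving the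
    difference onto [h] leaves [(c+k) f_k / (b+k) = f_k - (b-c)/b * f_k b/(b+k)]. *)
Lemma partial_sum_identity a b c e N : ~ nonpos_int e -> ~ nonpos_int b ->
  c * (csum (fun j => hyp2F1_term (a - 1) c e (S j) * harmonic b (S j)) N
       + (a + c - e) / e
         * (csum (fun k => hyp2F1_term a (c + 1) (e + 1) k * harmonic (b + 1) k) N
            + / b * csum (hyp2F1_term a (c + 1) (e + 1)) N))
  = (c + INR N) * hyp2F1_term a c e N * harmonic b N - csum (hyp2F1_term a c e) N
    + (b - c) / b * csum (fun j => hyp2F1_term a c e j * (b / (b + INR j))) N.
Proof.
  intros He Hb; induction N as [|N IH]; [simpl; unfold harmonic; simpl; ring |].
  simpl csum.
  set (S1 := csum _ N) in *. set (S2 := csum (fun k => _ * harmonic (b + 1) k) N) in *.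
  set (S3 := csum (hyp2F1_term a (c + 1) (e + 1)) N) in *.
  set (S4 := csum (hyp2F1_term a c e) N) in *. set (S5 := csum (fun j => _ * (b / _)) N) in *.
  pose proof (nonpos_int_add e N He). pose proof (nonpos_int_add b N Hb).
  pose proof (nonpos_int_neq_0 e He). pose proof (nonpos_int_neq_0 b Hb).
  pose proof (RtoC_S_neq_0 N).
  replace (c * _) with
    (c * (S1 + (a + c - e) / e * (S2 + / b * S3))
     + (c * hyp2F1_term (a - 1) c e (S N) * harmonic b (S N)
        + (a + c - e) / e * (c * hyp2F1_term a (c + 1) (e + 1) N) * (/ b + harmonic (b + 1) N)))
    by ring.
  rewrite IH, <- harmonic_S_l, hyp2F1_term_raise, hyp2F1_term_lower_S, hyp2F1_term_S, harmonic_S, RtoC_S by assumption.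
  field. repeat split; assumption.
Qed.

Theorem corollary3 (a b c e : C)
  (* no pole of Gamma(e), Gamma(e-a-c), Gamma(e-a), Gamma(e-c), nor of psi
     along b, b+1, b+2, ...; this also gives e <> 0, e <> a, and that no lower
     parameter of a series is a non-positive integer *)
  (he : ~ nonpos_int e)
  (heac : ~ nonpos_int (e - a - c))
  (hea : ~ nonpos_int (e - a))
  (hec : ~ nonpos_int (e - c))
  (hb : ~ nonpos_int b)
  (hbc : b <> c)
  (conv_3F2 : ex_hyp3F2 a c b e (b + 1))
  (conv_2F1hat : ex_hyp2F1hat (a - 1) c e b)
  (conv_2F1hat' : ex_hyp2F1hat a (c + 1) (e + 1) (b + 1)) :
  hyp3F2 a c b e (b + 1)
  = b * c / (b - c)
      * (hyp2F1hat (a - 1) c e b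
         + (a + c - e) / e * hyp2F1hat a (c + 1) (e + 1) (b + 1))
    + (1 + c ^ 2 / ((b - c) * (e - a)))
      * (CGamma e * CGamma (e - a - c) / (CGamma (e - a) * CGamma (e - c))).
Proof.
  pose proof (nonpos_int_neq_0 e he) as He0. pose proof (nonpos_int_neq_0 b hb) as Hb0.
  pose proof (nonpos_int_neq_0 _ hea) as Hea0.
  pose proof (nonpos_int_succ e he) as he1. pose proof (nonpos_int_succ b hb) as hb1.
  pose proof (hat_lim_0 _ _ _ _ hb1 conv_2F1hat') as L2.
  pose proof (hat_term_o_inv _ _ _ _ _ he1 L2) as Svh.
  pose proof (hyp2F1_term_o_inv _ _ _ _ _ he1 L2) as Sv.
  pose proof (hat_lim _ _ _ _ hb conv_2F1hat) as L1.
  pose proof (hyp3F2_lim _ _ _ _ he hb conv_3F2) as L5.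
  assert (Hc : eventually (fun n => c + INR n <> 0)) by apply eventually_add_INR_neq_0.
  (* [f_n = (c/e) ((e+n)/(c+n)) v_n] inherits the decay of [v_n]; for [c] a non-positive
     integer this makes sense only for large [n]. *)
  assert (Sf : o_inv (hyp2F1_term a c e)).
  { apply is_Clim_ext_loc with (fun n => c / e * ((e + INR n) / (c + INR n))
      * (INR n * hyp2F1_term a (c + 1) (e + 1) n)).
    - destruct Hc as [M HM]; exists M; intros n Hn. specialize (HM n Hn).
      pose proof (nonpos_int_add e n he).
      replace (c / e * ((e + INR n) / (c + INR n)) * (INR n * hyp2F1_term a (c + 1) (e + 1) n))
        with (/ e * ((e + INR n) / (c + INR n)) * INR n * (c * hyp2F1_term a (c + 1) (e + 1) n))
        by (unfold Cdiv; ring).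
      rewrite hyp2F1_term_raise by assumption. field. repeat split; assumption.
    - replace (RtoC 0) with (c / e * 1 * 0) by ring.
      apply is_Clim_mult; [| exact Sv]. apply is_Clim_scal, is_Clim_ratio. }
  assert (L4 : is_Clim (csum (hyp2F1_term a c e)) (gauss_value a c e)) by now apply gauss_summation.
  (* Only [Gamma (e)] and [Gamma (e - a)] shift, whence the factor [e / (e - a)]. *)
  assert (L3 : is_Clim (csum (hyp2F1_term a (c + 1) (e + 1))) (e / (e - a) * gauss_value a c e)).
  { replace (e / (e - a) * gauss_value a c e) with (gauss_value a (c + 1) (e + 1)).
    - apply gauss_summation; try assumption.
      + replace (e + 1 - a - (c + 1)) with (e - a - c) by ring. assumption.
      + replace (e + 1 - a) with (e - a + 1) by ring. now apply nonpos_int_succ.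
      + replace (e + 1 - (c + 1)) with (e - c) by ring. assumption.
    - unfold gauss_value.
      replace (e + 1 - a - (c + 1)) with (e - a - c) by ring.
      replace (e + 1 - a) with (e - a + 1) by ring.
      replace (e + 1 - (c + 1)) with (e - c) by ring.
      rewrite !CGamma_S by assumption.
      pose proof (CGamma_neq_0 _ hea). pose proof (CGamma_neq_0 _ hec).
      field. repeat split; assumption. }
  (* The boundary term is [(c/e) ((e+n)/n)] times
     [n v_n h'_n + n v_n (1/b - 1/(b+n))], and [n v_n h'_n] tends to 0. *)
  assert (L0 : is_Clim (fun N => (c + INR N) * hyp2F1_term a c e N * harmonic b N) 0).
  { apply is_Clim_ext_loc with (fun n => c / e * ((e + INR n) / INR n)
      * (INR n * (hyp2F1_term a (c + 1) (e + 1) n * harmonic (b + 1) n)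
         + INR n * hyp2F1_term a (c + 1) (e + 1) n * (/ b + (1 + (-1) * ((b + 1 + INR n) / (b + INR n)))))).
    - exists 1%nat; intros n Hn.
      assert (RtoC (INR n) <> 0).
      { intros E; apply RtoC_inj in E; revert E; apply not_0_INR; lia. }
      pose proof (nonpos_int_add e n he). pose proof (nonpos_int_add b n hb).
      replace (harmonic b n) with (/ b + harmonic (b + 1) n - / (b + INR n))
        by (rewrite <- harmonic_S_l, harmonic_S; ring).
      replace (_ * _) with (((e + INR n) / e) * (c * hyp2F1_term a (c + 1) (e + 1) n) *
        (/ b + harmonic (b + 1) n - / (b + INR n))) at 1 by (field; repeat split; assumption).
      rewrite hyp2F1_term_raise by assumption. field. repeat split; assumption.
    - replace (RtoC 0) with (c / e * 1 * (0 + 0 * (/ b + (1 + (-1) * 1)))) by ring.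
      apply is_Clim_mult; [apply is_Clim_scal, is_Clim_ratio_INR |].
      apply is_Clim_plus; [exact Svh |]. apply is_Clim_mult; [exact Sv |].
      apply is_Clim_plus; [apply is_Clim_const |].
      apply is_Clim_plus; [apply is_Clim_const |]. apply is_Clim_scal, is_Clim_ratio. }
  set (H1 := hyp2F1hat (a - 1) c e b) in *.
  set (H2 := hyp2F1hat a (c + 1) (e + 1) (b + 1)) in *.
  set (H3 := hyp3F2 a c b e (b + 1)) in *.
  change (CGamma e * CGamma (e - a - c) / (CGamma (e - a) * CGamma (e - c)))
    with (gauss_value a c e).
  set (g := gauss_value a c e) in *.
  assert (Hid : c * (H1 + (a + c - e) / e * (H2 + / b * (e / (e - a) * g)))
    = 0 + (-1) * g + (b - c) / b * H3).
  { eapply is_Clim_unique.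
    - apply is_Clim_scal, is_Clim_plus; [exact L1 |].
      apply is_Clim_scal, is_Clim_plus; [exact L2 |]. apply is_Clim_scal; exact L3.
    - eapply is_Clim_ext.
      2: { apply is_Clim_plus; [apply is_Clim_plus; [exact L0 | apply is_Clim_scal; exact L4] |].
           apply is_Clim_scal; exact L5. }
      intros N. cbv beta. rewrite partial_sum_identity by assumption. ring. }
  assert (Hbc : b - c <> 0) by now apply Cminus_eq_contra.
  assert (E3 : H3 = b / (b - c) * (c * (H1 + (a + c - e) / e * (H2 + / b * (e / (e - a) * g))) + g)).
  { rewrite Hid. field. split; assumption. }
  rewrite E3. field. repeat split; assumption.
Qed.
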